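(* There exists an absolute constant $C>1$ such that for all integers $d\ge 2$ and $n\ge 2d$, $$n\cdot\operatorname{disp}_{\mathcal C}(n,d)\le C\,d\,\ln\ln\frac{2n}{d}.$$
   Context: $\mathbb S^d\subset\mathbb R^{d+1}$ is the Euclidean unit sphere, $\sigma$ the normalized (total mass $1$) Lebesgue surface measure on $\mathbb S^d$. The family of spherical caps is $\mathcal C=\{B(x,\varphi):x\in\mathbb S^d,\varphi\in[0,\pi]\}$, where $B(x,\varphi)=\{y\in\mathbb S^d:\arccos\langle x,y\rangle\le\varphi\}$. The minimal spherical cap dispersion is $$\operatorname{disp}_{\mathcal C}(n,d)=\inf_{x_1,\dots,x_n\in\mathbb S^d}\ \sup\{\sigma(A): A\in\mathcal C,\ A\cap\{x_1,\dots,x_n\}=\emptyset\}.$$ *)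

(* Defs.v *)
From HB Require Import structures.
From mathcomp Require Import all_boot all_order all_algebra.
From mathcomp Require Import all_classical all_reals all_analysis.

Set Implicit Arguments.
Unset Strict Implicit.
Unset Printing Implicit Defensive.

Import Order.TTheory GRing.Theory Num.Theory.
Import numFieldNormedType.Exports.

Local Open Scope classical_set_scope.
Local Open Scope ring_scope.

Section cons_measure.
Local Open Scope ereal_scope.
Context d (T : measurableType d) (R : realType) (n : nat).
Variable mu : {sigma_finite_measure set T -> \bar R}.
Variable m : {sigma_finite_measure set (n.-tuple T) -> \bar R}.

Definition tcons (p : T * n.-tuple T) : n.+1.-tuple T := [tuple of p.1 :: p.2].

Lemma measurable_tcons : measurable_fun [set: T * n.-tuple T] tcons.
Proof. exact: measurable_cons measurable_fst measurable_snd. Qed.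

Definition cons_measure := pushforward (mu \x m) tcons.

Let cons_measure0 : cons_measure set0 = 0.
Proof. by rewrite /cons_measure /pushforward preimage_set0 measure0. Qed.

Let cons_measure_ge0 A : 0 <= cons_measure A.
Proof. by rewrite /cons_measure /pushforward; exact: measure_ge0. Qed.

Let cons_measure_sigma_additive : semi_sigma_additive cons_measure.
Proof.
move=> F mF tF mUF; rewrite /cons_measure /pushforward preimage_bigcup.
have mpre i : measurable (tcons @^-1` F i).
  by rewrite -[X in measurable X]setTI; exact: measurable_tcons.
apply: measure_semi_sigma_additive => //; last exact: bigcup_measurable.
apply/trivIsetP => /= i j _ _ ij; rewrite -preimage_setI.
by move/trivIsetP : tF => /(_ _ _ _ _ ij) ->//; rewrite preimage_set0.
Qed.

HB.instance Definition _ := isMeasure.Build _ _ _ cons_measure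
  cons_measure0 cons_measure_ge0 cons_measure_sigma_additive.

Let cons_measure_sigma_finite : sigma_finite setT cons_measure.
Proof.
have /sigma_finiteP[F [TF ndF Foo]] := sigma_finiteT mu.
have /sigma_finiteP[G [TG ndG Goo]] := sigma_finiteT m.
pose unc (t : n.+1.-tuple T) : T * n.-tuple T := (thead t, [tuple of behead t]).
have tconsK : cancel tcons unc.
  by move=> [x t]; congr pair; exact: val_inj.
have munc : measurable_fun [set: n.+1.-tuple T] unc.
  apply/measurable_fun_pair => /=; first exact: measurable_tnth.
  exact: measurable_behead.
exists (fun k => unc @^-1` (F k `*` G k)).
  rewrite predeqE => t; split=> // _.
  have [i _ Fi] : (\bigcup_i F i) (unc t).1 by rewrite -TF.
  have [j _ Gj] : (\bigcup_i G i) (unc t).2 by rewrite -TG.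
  exists (maxn i j) => //; split.
  - by move: Fi; exact/subsetPset/ndF/leq_maxl.
  - by move: Gj; exact/subsetPset/ndG/leq_maxr.
move=> k; have [mFk Fkoo] := Foo k; have [mGk Gkoo] := Goo k; split.
  by rewrite -[X in measurable X]setTI; apply: munc => //; exact: measurableX.
rewrite /cons_measure /pushforward -comp_preimage.
rewrite (_ : unc \o tcons = id) ?preimage_id.
  by rewrite product_measure1E// lte_mul_pinfty// ge0_fin_numE.
by apply/funext => p; exact: tconsK.
Qed.

HB.instance Definition _ := Measure_isSigmaFinite.Build _ _ _ cons_measure
  cons_measure_sigma_finite.

End cons_measure.

(* The [n]-fold product of [mu] with itself; [0.-tuple T] is a point, of
   mass 1. *)
Fixpoint tuple_measure d (T : measurableType d) (R : realType)
    (mu : {sigma_finite_measure set T -> \bar R}) (n : nat) :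
    {sigma_finite_measure set (n.-tuple T) -> \bar R} :=
  match n with
  | 0 => \d_([tuple] : 0.-tuple T)
  | k.+1 => cons_measure mu (tuple_measure mu k)
  end.

Section sphere.
Context (R : realType).

(* Lebesgue measure of a set of row vectors; the measurable structure of R^n is
   carried by tuples. *)
Definition lebesgue_rV (n : nat) (A : set 'rV[R]_n) : \bar R :=
  tuple_measure (@lebesgue_measure R) n
    [set t : n.-tuple (measurableTypeR R) | A (\row_i tnth t i)].

Definition dotmul (n : nat) (x y : 'rV[R]_n) : R := \sum_(i < n) x 0 i * y 0 i.

(* [sphere d] is S^d, in R^(d+1). *)
Definition sphere (d : nat) : set 'rV[R]_d.+1 := [set x | dotmul x x = 1].
Arguments sphere d : clear implicits.

Definition cone (n : nat) (A : set 'rV[R]_n) : set 'rV[R]_n :=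
  [set z | exists t : R, exists2 x, A x & 0 <= t <= 1 /\ z = t *: x].

(* The surface measure of a part [A] of S^d is [d.+1] times the Lebesgue measure
   of the cone of [A] (polar coordinates). Dividing by the total surface area of
   S^d, where [cone (sphere d)] is the closed unit ball, the factor [d.+1]
   cancels. *)
Definition sigma (d : nat) (A : set 'rV[R]_d.+1) : \bar R :=
  (lebesgue_rV (cone A) / lebesgue_rV (cone (sphere d)))%E.

Definition cap (d : nat) (x : 'rV[R]_d.+1) (phi : R) : set 'rV[R]_d.+1 :=
  [set y | sphere d y /\ acos (dotmul x y) <= phi].

Definition caps (d : nat) : set (set 'rV[R]_d.+1) :=
  [set A | exists x phi, [/\ sphere d x, 0 <= phi <= pi & A = cap x phi]].
Arguments caps d : clear implicits.

Definition disp (n d : nat) : \bar R :=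
  ereal_inf [set ereal_sup [set sigma A | A in
                    [set A | caps d A /\ A `&` range X = set0]]
            | X in [set X : 'I_n -> 'rV[R]_d.+1 | forall i, sphere d (X i)]].

End sphere.

(* Main.v *)
(* For y fixed, a cap of angle phi around x contains y iff the cap of angle phi
   around y contains x, so the theorem is about covering the sphere by n equal
   caps {z | <z, x> >= c}. Let p be their normalized measure and D = d + 1. All
   estimates on p = f(c) come from mapping cones over caps into each other by
   translations and homotheties.

   If c > 1/2, then D is O(ln (1/p)), and Rogers' argument suffices: take a net
   of mesh r / (4 D), r being the chordal radius of the caps, choose points
   greedily so as to hit the caps of radius (1 - 1/(4 D)) r around the points of
   the net, and add the 1/p or fewer points of the net that remain; this costs
   O(D ln D / p) points.

   If c <= 1/2, then f decreases by at most a constant factor when c increases by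
   2 h, where h is about 1 / (sqrt D * max 1 (c * sqrt D)). Choose points z
   greedily so as to decrease the sum, over the points y of a cubic lattice of
   mesh h/56 which are near the sphere, of the product over z of a gain g(z, y),
   which is 3/4 or slightly more when <z, y> is above c + h and exceeds 1 only by
   an amount exponentially small in (c - <z, y>) / h below that level. The mean
   of g over z is at most 1 - p/32. If x is not covered, then rounding x at
   random to the lattice, coordinatewise and without bias, gives E[- ln g] <= 0
   for every chosen z, and hence E[prod g] >= 1 by Jensen. The number of lattice
   points being exp (O(D ln (h sqrt D)^-1)), this is impossible once
   O(D ln (h sqrt D)^-1 / p) points have been chosen, and h sqrt D is at least of
   order (ln (1/p))^-1. *)

Require Import Defs.
From HB Require Import structures.
From mathcomp Require Import all_boot all_order all_algebra.
From mathcomp Require Import ring lra.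
From mathcomp Require Import all_classical all_reals all_analysis measurable_realfun.

Set Implicit Arguments.
Unset Strict Implicit.
Unset Printing Implicit Defensive.

Import Order.TTheory GRing.Theory Num.Theory.
Import numFieldNormedType.Exports.

Local Open Scope classical_set_scope.
Local Open Scope ring_scope.

(** * Lebesgue measure on tuples and affine maps *)

Lemma tnth_tcons d (T : measurableType d) n (p : T * n.-tuple T) (j : 'I_n) :
  tnth (tcons p) (lift ord0 j) = tnth p.2 j.
Proof. by rewrite !(tnth_nth p.1). Qed.

Section affine.
Context (R : realType).
Local Notation leb := (@lebesgue_measure R).
Local Notation T := (measurableTypeR R).

Lemma measurable_affine (s v : R) : measurable_fun [set: T] (fun x : T => s * x + v : T).
Proof.
apply: measurable_funD; last exact: measurable_cst.
by apply: measurable_funM; [exact: measurable_cst|exact: measurable_id].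
Qed.

(** The pushforward under the affine map, multiplied by [s], agrees with Lebesgue measure on
    half-open intervals, hence everywhere by uniqueness. *)
Lemma lebesgue_measure_affine (s v : R) (A : set T) : 0 < s -> measurable A ->
  leb [set x | A (s * x + v)] = (s^-1%:E * leb A)%E.
Proof.
move=> s0 mA; pose phi : T -> T := fun x => s * x + v.
have mphi : measurable_fun setT phi by exact: measurable_affine.
have [pm pmE] : exists pm : {measure set T -> \bar R}, forall B, pm B = pushforward leb phi B.
  by unshelve eexists [the {measure set T -> \bar R} of pushforward leb phi].
pose mu' := mscale (NngNum (ltW s0)) pm.
have -> : leb A = mu' A.
  apply: (@lebesgue_measure_unique R mu') => //.
  move=> _ [[a b] _ <-] /=.
  rewrite /mu' /mscale /= pmE /pushforward.
  rewrite (_ : phi @^-1` _ = `](a - v) / s, (b - v) / s]%classic); last first.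
    apply/seteqP; split => x /=; rewrite !in_itv /= ltr_pdivrMr // ler_pdivlMr //;
      by rewrite ltrBlDr lerBrDr (mulrC x).
  rewrite !lebesgue_measure_itv /= !lte_fin.
  rewrite ltr_pM2r ?invr_gt0// ltrD2r; case: ifP => // _; last by rewrite mule0.
  by rewrite -!EFinD -EFinM; congr EFin; field; rewrite gt_eqF.
by rewrite /mu' /mscale /= pmE /pushforward muleA -EFinM mulVf ?mul1e // gt_eqF.
Qed.

Lemma ge0_integral_affine (s v : R) (f : T -> \bar R) : 0 < s ->
  measurable_fun setT f -> (forall x, 0 <= f x)%E ->
  (\int[leb]_x f (s * x + v)%R = s^-1%:E * \int[leb]_x f x)%E.
Proof.
move=> s0 mf f0.
have mA := measurable_affine s v.
pose phi := (fun x : T => s * x + v : T).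
transitivity (\int[pushforward leb phi]_x f x)%E.
  by rewrite (ge0_integral_pushforward mA) //.
have si : 0 <= s^-1 by rewrite invr_ge0 ltW.
rewrite (@eq_measure_integral _ _ _ setT (mscale (NngNum si) leb)); last first.
  by move=> A mA' _; exact: lebesgue_measure_affine.
by rewrite ge0_integral_mscale.
Qed.

Local Notation mu := (tuple_measure leb).

Definition afft (n : nat) (s : R) (v : 'I_n -> R) (t : n.-tuple T) : n.-tuple T :=
  [tuple (s * tnth t i + v i : T) | i < n].

Lemma afft_cons n s (v : 'I_n.+1 -> R) p :
  afft s v (tcons p) = tcons (s * p.1 + v ord0, afft s (v \o lift ord0) p.2).
Proof.
apply: eq_from_tnth => i; rewrite tnth_mktuple.
case: (unliftP ord0 i) => [j ->|->]; last by rewrite !tnth0.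
rewrite [RHS](tnth_tcons (s * p.1 + v ord0, _) j) tnth_mktuple.
by congr (s * _ + _); exact: tnth_tcons.
Qed.

Lemma tuple_measure_affine n s (v : 'I_n -> R) A : 0 < s -> measurable A ->
  mu n [set t | A (afft s v t)] = ((s ^- n)%:E * mu n A)%E.
Proof.
move=> s0; elim: n v A => [|n IH] v A mA.
  rewrite expr0 invr1 mul1e; congr (mu 0 _).
  by apply/seteqP; split => t /=; rewrite (tuple0 (afft _ _ _)) (tuple0 t).
rewrite /= /cons_measure /pushforward /product_measure1.
have mtA : measurable (@tcons _ T n @^-1` A).
  by rewrite -[X in measurable X]setTI; exact: measurable_tcons.
pose F := (mu n \o xsection (@tcons _ T n @^-1` A)).
transitivity (\int[leb]_x ((s ^- n)%:E * F (s * x + v ord0)%R))%E.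
  apply: eq_integral => x _ /=.
  rewrite -(IH (v \o lift ord0)) ; last exact: measurable_xsection.
  congr (mu n _); apply/seteqP; split => t; rewrite /xsection /= !inE /= afft_cons //.
have mF : measurable_fun setT F by exact: measurable_fun_xsection.
have F0 x : (0 <= F x)%E by exact: measure_ge0.
rewrite ge0_integralZl //=; last 2 first.
- exact: (measurableT_comp mF (measurable_affine _ _)).
- by rewrite lee_fin invr_ge0 exprn_ge0 // ltW.
by rewrite ge0_integral_affine // muleA -EFinM exprS invfM mulrC.
Qed.

End affine.

(** * Row vectors and linear isometries *)

Section rowvectors.
Context (R : realType).
Local Notation leb := (@lebesgue_measure R).
Local Notation T := (measurableTypeR R).
Local Notation mu := (tuple_measure leb).

Definition rowt n (t : n.-tuple T) : 'rV[R]_n := \row_i tnth t i.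
Definition trow n (x : 'rV[R]_n) : n.-tuple T := [tuple (x 0 i : T) | i < n].

Lemma trowK n : cancel (@trow n) (@rowt n).
Proof. by move=> x; apply/rowP => i; rewrite mxE tnth_mktuple. Qed.

(** Row vectors borrow the sigma-algebra of tuples, on which [lebesgue_rV] is computed. *)
Definition rmeasurable n (A : set 'rV[R]_n) := measurable (@rowt n @^-1` A).

Definition rmeasurable_fun d (X : measurableType d) n (g : X -> 'rV[R]_n) :=
  forall i, measurable_fun setT (fun x => g x 0 i).

Lemma rmeasurable_preimage d (X : measurableType d) n (g : X -> 'rV[R]_n) A :
  rmeasurable_fun g -> rmeasurable A -> measurable (g @^-1` A).
Proof.
move=> mg mA.
have mtg : measurable_fun setT (@trow n \o g).
  apply/measurable_fun_tnthP => i; apply: eq_measurable_fun (mg i) => x _ /=.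
  by rewrite tnth_mktuple.
rewrite (_ : g @^-1` A = (@trow n \o g) @^-1` (@rowt n @^-1` A)).
  by rewrite -[X in measurable X]setTI; exact: mtg.
by rewrite -comp_preimage; apply/seteqP; split => x /=; rewrite trowK.
Qed.

Lemma rmeasurable_rowt n : rmeasurable_fun (@rowt n).
Proof.
move=> i; apply: eq_measurable_fun (measurable_tnth i) => t _.
by rewrite mxE.
Qed.

Lemma rmeasurable_cst d (X : measurableType d) n (v : 'rV[R]_n) :
  rmeasurable_fun (fun _ : X => v).
Proof. by move=> i; exact: measurable_cst. Qed.

Lemma rmeasurable_funD d (X : measurableType d) n (f g : X -> 'rV[R]_n) :
  rmeasurable_fun f -> rmeasurable_fun g -> rmeasurable_fun (fun x => f x + g x).
Proof.
move=> mf mg i; apply: eq_measurable_fun (measurable_funD (mf i) (mg i)) => x _.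
by rewrite mxE.
Qed.

Lemma rmeasurable_funZ d (X : measurableType d) n (s : X -> R) (g : X -> 'rV[R]_n) :
  measurable_fun setT s -> rmeasurable_fun g -> rmeasurable_fun (fun x => s x *: g x).
Proof.
move=> ms mg i; apply: eq_measurable_fun (measurable_funM ms (mg i)) => x _.
by rewrite mxE.
Qed.

Lemma rmeasurable_funN d (X : measurableType d) n (g : X -> 'rV[R]_n) :
  rmeasurable_fun g -> rmeasurable_fun (fun x => - g x).
Proof.
move=> mg i; apply: eq_measurable_fun (measurable_funN (mg i)) => x _.
by rewrite mxE.
Qed.

Lemma measurable_dotmul d (X : measurableType d) n (f g : X -> 'rV[R]_n) :
  rmeasurable_fun f -> rmeasurable_fun g ->
  measurable_fun setT (fun x => dotmul (f x) (g x)).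
Proof.
by move=> mf mg; apply: measurable_sum => i; exact: measurable_funM.
Qed.

Lemma rmeasurable_comp d (X : measurableType d) n m (h : 'rV[R]_n -> 'rV[R]_m)
    (g : X -> 'rV[R]_n) :
  rmeasurable_fun (h \o @rowt n) -> rmeasurable_fun g -> rmeasurable_fun (h \o g).
Proof.
move=> mh mg i.
have mtg : measurable_fun setT (@trow n \o g).
  apply/measurable_fun_tnthP => j; apply: eq_measurable_fun (mg j) => x _ /=.
  by rewrite tnth_mktuple.
apply: eq_measurable_fun (measurableT_comp (mh i) mtg) => x _ /=.
by rewrite trowK.
Qed.

Lemma lebesgue_rV_affine n s (v : 'rV[R]_n) A : 0 < s -> rmeasurable A ->
  lebesgue_rV [set z | A (s *: z + v)] = ((s ^- n)%:E * lebesgue_rV A)%E.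
Proof.
move=> s0 mA; rewrite /lebesgue_rV -(tuple_measure_affine (fun i => v 0 i) s0 mA).
congr (mu n _); apply/seteqP; split => t /=;
  suff -> : s *: rowt t + v = rowt (afft s (fun i => v 0 i) t) by [];
  by apply/rowP => i; rewrite !mxE tnth_mktuple.
Qed.

Lemma tonelli_sections n (S : set (n.-tuple T * n.-tuple T)) : measurable S ->
  (\int[mu n]_x mu n (xsection S x) = \int[mu n]_y mu n (ysection S y))%E.
Proof.
move=> mS.
have F := indic_fubini_tonelli_FE (mu n) mS.
have G := indic_fubini_tonelli_GE (mu n) mS.
transitivity (\int[mu n]_x fubini_F (mu n) (EFin \o \1_S) x)%E; first by rewrite F.
by rewrite indic_fubini_tonelli // G.
Qed.

(* Translation invariance alone determines Lebesgue measure up to a factor, by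
   Tonelli; the factor is 1 when some symmetric set of positive finite measure
   is invariant. *)
Lemma lebesgue_rV_isometry n (U : 'rV[R]_n -> 'rV[R]_n) (A B : set 'rV[R]_n) :
  {morph U : x y / x + y} -> involutive U -> rmeasurable_fun (U \o @rowt n) ->
  (forall x, B (- U x) <-> B x) -> rmeasurable A -> rmeasurable B ->
  lebesgue_rV B \is a fin_num -> lebesgue_rV B != 0%E ->
  lebesgue_rV [set z | A (U z)] = lebesgue_rV A.
Proof.
move=> UD UK mU BU mA mB finB B0.
have m1 : rmeasurable_fun (fun p : n.-tuple T * n.-tuple T => rowt p.1).
  by move=> i; exact: measurableT_comp (rmeasurable_rowt i) measurable_fst.
have m2 : rmeasurable_fun (fun p : n.-tuple T * n.-tuple T => rowt p.2).
  by move=> i; exact: measurableT_comp (rmeasurable_rowt i) measurable_snd.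
have mU1 := rmeasurable_comp mU m1.
(* Integrating the sections over a fixed first coordinate gives the two products to compare, in [e1]
   and [e2]. Over a fixed second coordinate [y], the translation by [U y] carries one section to the
   other, as [e12] shows. *)
pose S1 := [set p : n.-tuple T * n.-tuple T |
  A (U (rowt p.1)) /\ B (rowt p.2 - U (rowt p.1))].
pose S2 := [set p : n.-tuple T * n.-tuple T |
  A (rowt p.2 + U (rowt p.1)) /\ B (rowt p.1)].
have mS1 : measurable S1.
  apply: measurableI; first exact: (rmeasurable_preimage mU1 mA).
  apply: (rmeasurable_preimage (g := fun p => rowt p.2 - U (rowt p.1))) mB.
  by apply: rmeasurable_funD m2 _; exact: rmeasurable_funN.
have mS2 : measurable S2.
  apply: measurableI; last exact: (rmeasurable_preimage m1 mB).
  apply: (rmeasurable_preimage (g := fun p => rowt p.2 + U (rowt p.1))) mA.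
  exact: rmeasurable_funD m2 _.
have mUA : rmeasurable [set z | A (U z)] by exact: (rmeasurable_preimage mU mA).
have shift (v : 'rV[R]_n) C : rmeasurable C -> lebesgue_rV [set z | C (z + v)] = lebesgue_rV C.
  move=> mC; have := lebesgue_rV_affine v ltr01 mC.
  rewrite expr1n invr1 mul1e => <-; congr lebesgue_rV.
  by apply/seteqP; split => z /=; rewrite scale1r.
have e1 : (\int[mu n]_x mu n (xsection S1 x) =
    lebesgue_rV B * lebesgue_rV [set z | A (U z)])%E.
  transitivity (\int[mu n]_x (lebesgue_rV B *
     (\1_(@rowt n @^-1` [set z | A (U z)]) x)%:E))%E.
    apply: eq_integral => x _.
    rewrite indicE; case: (boolP (x \in _)) => [/set_mem /= AUx|]; rewrite ?mule1 ?mule0.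
      rewrite -(shift (- U (rowt x)) B mB) /lebesgue_rV; congr (mu n _).
      by apply/seteqP; split => y; rewrite /xsection /= !inE /= => // -[].
    rewrite notin_setE /= => nA; rewrite (_ : xsection _ _ = set0) ?measure0//.
    by apply/seteqP; split => y //; rewrite /xsection /= !inE /= => -[].
  rewrite ge0_integralZl //=; first by rewrite integral_indic ?setIT.
  by apply/measurable_EFinP; exact: measurable_indic.
have e2 : (\int[mu n]_x mu n (xsection S2 x) = lebesgue_rV A * lebesgue_rV B)%E.
  transitivity (\int[mu n]_x (lebesgue_rV A * (\1_(@rowt n @^-1` B) x)%:E))%E.
    apply: eq_integral => x _.
    rewrite indicE; case: (boolP (x \in _)) => [/set_mem /= Bx|]; rewrite ?mule1 ?mule0.
      rewrite -(shift (U (rowt x)) A mA) /lebesgue_rV; congr (mu n _).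
      by apply/seteqP; split => y; rewrite /xsection /= !inE /= => // -[].
    rewrite notin_setE /= => nA; rewrite (_ : xsection _ _ = set0) ?measure0//.
    by apply/seteqP; split => y //; rewrite /xsection /= !inE /= => -[].
  rewrite ge0_integralZl //=; first by rewrite integral_indic ?setIT.
  by apply/measurable_EFinP; exact: measurable_indic.
have e12 : (\int[mu n]_y mu n (ysection S1 y) = \int[mu n]_y mu n (ysection S2 y))%E.
  apply: eq_integral => y _.
  have mC : rmeasurable [set z | A (U z) /\ B (rowt y - U z)].
    apply: measurableI => //.
    apply: (rmeasurable_preimage (g := fun t => rowt y - U (rowt t))) mB.
    by apply: rmeasurable_funD; [exact: rmeasurable_cst|exact: rmeasurable_funN].
  transitivity (lebesgue_rV [set z | A (U z) /\ B (rowt y - U z)]).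
    by congr (mu n _); apply/seteqP; split => x; rewrite /ysection /= !inE.
  rewrite -(shift (U (rowt y)) _ mC); congr (mu n _).
  apply/seteqP; split => x; rewrite /ysection /= !inE /= UD UK addrC opprD addrA subrr add0r.
    by move=> [? /BU ?].
  by move=> [? ?]; split => //; apply/BU.
move: (tonelli_sections mS1); rewrite e12 -(tonelli_sections mS2) e1 e2 muleC.
move: finB B0 => /fineK <-; rewrite eqe => B0.
move=> /(congr1 (fun x => x * (fine (lebesgue_rV B))^-1%:E))%E.
by rewrite -!muleA -!EFinM mulfV // !mule1.
Qed.

End rowvectors.

(** * Inner product, reflections and balls *)

Section dotmul.
Context (R : realType) (n : nat).
Implicit Types (x y z u : 'rV[R]_n) (a : R).

Lemma dotmulC x y : dotmul x y = dotmul y x.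
Proof. by apply: eq_bigr => i _; rewrite mulrC. Qed.

Lemma dotmulDl x y z : dotmul (x + y) z = dotmul x z + dotmul y z.
Proof. by rewrite -big_split; apply: eq_bigr => i _; rewrite mxE mulrDl. Qed.

Lemma dotmulZl a x y : dotmul (a *: x) y = a * dotmul x y.
Proof. by rewrite mulr_sumr; apply: eq_bigr => i _; rewrite mxE mulrA. Qed.

Lemma dotmulNl x y : dotmul (- x) y = - dotmul x y.
Proof. by rewrite -scaleN1r dotmulZl mulN1r. Qed.

Lemma dotmulBl x y z : dotmul (x - y) z = dotmul x z - dotmul y z.
Proof. by rewrite dotmulDl dotmulNl. Qed.

Lemma dotmulDr x y z : dotmul z (x + y) = dotmul z x + dotmul z y.
Proof. by rewrite !(dotmulC z) dotmulDl. Qed.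

Lemma dotmulZr a x y : dotmul y (a *: x) = a * dotmul y x.
Proof. by rewrite !(dotmulC y) dotmulZl. Qed.

Lemma dotmulNr x y : dotmul y (- x) = - dotmul y x.
Proof. by rewrite !(dotmulC y) dotmulNl. Qed.

Lemma dotmulBr x y z : dotmul z (x - y) = dotmul z x - dotmul z y.
Proof. by rewrite !(dotmulC z) dotmulBl. Qed.

Lemma dotmul_ge0 x : 0 <= dotmul x x.
Proof. by apply: sumr_ge0 => i _; rewrite -expr2 sqr_ge0. Qed.

Lemma dotmul_eq0 x : (dotmul x x == 0) = (x == 0).
Proof.
apply/eqP/eqP => [h|->]; last by rewrite -(scale0r 0) dotmulZl mul0r.
apply/rowP => i; rewrite mxE.
have h' : \sum_j x 0 j ^+ 2 = 0.
  by rewrite -[RHS]h; apply: eq_bigr => j _; rewrite expr2.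
have /eqP := psumr_eq0P (fun j _ => sqr_ge0 (x 0 j)) h' (i := i) isT.
by rewrite sqrf_eq0 => /eqP.
Qed.

Definition enorm x := Num.sqrt (dotmul x x).

Lemma enorm_ge0 x : 0 <= enorm x. Proof. exact: sqrtr_ge0. Qed.

Lemma sqr_enorm x : enorm x ^+ 2 = dotmul x x.
Proof. by rewrite sqr_sqrtr // dotmul_ge0. Qed.

Lemma enorm_eq0 x : (enorm x == 0) = (x == 0).
Proof. by rewrite -(sqrf_eq0 (enorm x)) sqr_enorm dotmul_eq0. Qed.

Lemma enorm_gt0 x : (0 < enorm x) = (x != 0).
Proof. by rewrite lt_def enorm_eq0 enorm_ge0 andbT. Qed.

Lemma enormZ a x : enorm (a *: x) = `|a| * enorm x.
Proof.
by rewrite /enorm dotmulZl dotmulZr mulrA -expr2 sqrtrM ?sqr_ge0 // sqrtr_sqr.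
Qed.

Lemma enormN x : enorm (- x) = enorm x.
Proof. by rewrite -scaleN1r enormZ normrN normr1 mul1r. Qed.

(** Cauchy-Schwarz, by expanding the square of [enorm y *: x - enorm x *: y]. *)
Lemma dotmul_le x y : dotmul x y <= enorm x * enorm y.
Proof.
have [->|x0] := eqVneq x 0.
  by rewrite -(scale0r 0) dotmulZl enormZ normr0 !mul0r.
have [->|y0] := eqVneq y 0.
  by rewrite -(scale0r 0) dotmulZr enormZ normr0 !mul0r mulr0.
have := dotmul_ge0 (enorm y *: x - enorm x *: y).
rewrite !(dotmulBl, dotmulBr, dotmulZl, dotmulZr) -!sqr_enorm (dotmulC y x).
have : 0 < enorm x * enorm y by rewrite mulr_gt0 // enorm_gt0.
set a := enorm x; set b := enorm y; set c := dotmul x y => ab0.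
rewrite (_ : _ - _ = 2 * (a * b) * (a * b - c)); last ring.
by rewrite pmulr_rge0 ?subr_ge0 //; lra.
Qed.

Lemma enormD x y : enorm (x + y) <= enorm x + enorm y.
Proof.
rewrite -(ler_pXn2r (ltn0Sn 1)) ?nnegrE ?addr_ge0 ?enorm_ge0 //.
rewrite sqr_enorm !(dotmulDl, dotmulDr) (dotmulC y x) sqrrD !sqr_enorm.
have := dotmul_le x y; lra.
Qed.

Lemma enormB x y : enorm (x - y) = enorm (y - x).
Proof. by rewrite -enormN opprB. Qed.

(** The reflection in the hyperplane orthogonal to [u]. As division by zero gives 0, it is the
    identity for [u = 0], so that the lemmas below hold for every [u]. *)
Definition refl u x := x - (2 * dotmul u x / dotmul u u) *: u.

Lemma reflD u : {morph refl u : x y / x + y}.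
Proof.
move=> x y; rewrite /refl dotmulDr mulrDr mulrDl scalerDl.
by rewrite opprD !addrA; congr (_ - _); rewrite -!addrA (addrC y).
Qed.

Lemma dotmul_refl u x y : dotmul (refl u x) (refl u y) = dotmul x y.
Proof.
rewrite /refl !(dotmulBl, dotmulBr, dotmulZl, dotmulZr) (dotmulC x u).
have [->|u0] := eqVneq u 0; first by rewrite -(scale0r 0) !dotmulZl; ring.
by field; rewrite dotmul_eq0.
Qed.

Lemma reflK u : involutive (refl u).
Proof.
move=> x; rewrite /refl dotmulBr dotmulZr.
have [->|u0] := eqVneq u 0; first by rewrite !scaler0 !subr0.
rewrite -addrA -opprD -scalerDl; set c : R := (X in X *: u).
suff -> : c = 0 by rewrite scale0r subr0.
by rewrite /c; field; rewrite dotmul_eq0.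
Qed.

Lemma refl_unit x y : dotmul x x = 1 -> dotmul y y = 1 -> refl (x - y) x = y.
Proof.
move=> x1 y1; have [->|xy] := eqVneq x y.
  by rewrite /refl subrr scaler0 subr0.
have : dotmul (x - y) (x - y) != 0 by rewrite dotmul_eq0 subr_eq0.
rewrite /refl !(dotmulBl, dotmulBr) x1 y1 (dotmulC y x) => h.
set c : R := (X in X *: _); suff -> : c = 1 by rewrite scale1r subKr.
by rewrite /c; field.
Qed.

End dotmul.

Section ball.
Context (R : realType).
Local Notation leb := (@lebesgue_measure R).
Local Notation T := (measurableTypeR R).
Local Notation mu := (tuple_measure leb).

Lemma tuple_measure_box n (a b : R) : a <= b ->
  measurable [set t : n.-tuple T | forall i, a <= tnth t i <= b] /\
  mu n [set t | forall i, a <= tnth t i <= b] = ((b - a) ^+ n)%:E.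
Proof.
move=> ab; elim: n => [|n [mS IH]].
  have -> : [set t : 0.-tuple T | forall i, a <= tnth t i <= b] = setT.
    by apply/seteqP; split => t //= _ [].
  split; first exact: measurableT.
  by rewrite /= diracT expr0.
have E : @tcons _ T n @^-1` [set t | forall i, a <= tnth t i <= b] =
    `[a, b]%classic `*` [set t | forall i, a <= tnth t i <= b].
  apply/seteqP; split => -[x t] /=; rewrite in_itv /=.
    move=> h; split; first by have := h ord0; rewrite tnth0.
    by move=> i; have := h (lift ord0 i); rewrite tnth_tcons.
  move=> [h1 h2] i; case: (unliftP ord0 i) => [j ->|->]; last by rewrite tnth0.
  by rewrite tnth_tcons.
split.
  rewrite (_ : mkset _ = \bigcap_(i in [set: 'I_n.+1])
      ((@tnth n.+1 T ^~ i) @^-1` `[a, b]%classic)).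
    apply: fin_bigcap_measurable; first exact: finite_finset.
    move=> i _; rewrite -[X in measurable X]setTI.
    by apply: measurable_tnth => //; exact: measurable_itv.
  apply/seteqP; split => t /= h i.
    by move=> _; rewrite /= in_itv /=; exact: h.
  by have := h i I; rewrite /= in_itv.
have L : leb `[a, b]%classic = (b - a)%:E.
  rewrite lebesgue_measure_itv /= lte_fin; case: ltP => [_|ba]; first by rewrite -EFinD.
  by have -> : a = b by [apply/eqP; rewrite eq_le ab]; rewrite subrr.
rewrite /= /cons_measure /pushforward E exprS EFinM -L -IH.
by apply: product_measure1E => //; exact: measurable_itv.
Qed.

Lemma rmeasurable_le n (f g : 'rV[R]_n -> R) :
  measurable_fun setT (f \o @rowt R n) -> measurable_fun setT (g \o @rowt R n) ->
  rmeasurable [set z | f z <= g z].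
Proof.
move=> mf mg; have := measurable_fun_ler mf mg measurableT (Y := [set true]) I.
by rewrite setTI /rmeasurable; congr measurable; apply/seteqP; split.
Qed.

Lemma ball_rmeasurable n : rmeasurable [set z : 'rV[R]_n | dotmul z z <= 1].
Proof.
apply: (rmeasurable_le (g := fun=> 1)); last exact: measurable_cst.
exact: measurable_dotmul (@rmeasurable_rowt R n) (@rmeasurable_rowt R n).
Qed.

Lemma lebesgue_rV_le n (A B : set 'rV[R]_n) : rmeasurable A -> rmeasurable B ->
  A `<=` B -> (lebesgue_rV A <= lebesgue_rV B)%E.
Proof. by move=> mA mB AB; apply: le_measure; rewrite ?inE // => t /AB. Qed.

Lemma lebesgue_ball_fin n :
  lebesgue_rV [set z : 'rV[R]_n | dotmul z z <= 1] \is a fin_num.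
Proof.
have h : (-1 : R) <= 1 by lra.
have [mS E] := tuple_measure_box n h.
rewrite ge0_fin_numE ?measure_ge0 //.
apply: (@le_lt_trans _ _ (mu n [set t | forall i, -1 <= tnth t i <= 1])); last first.
  by rewrite E ltry.
apply: le_measure; rewrite ?inE //; first exact: ball_rmeasurable.
move=> t /= h1 i; rewrite -ler_norml -[leRHS]sqrtr1 -sqrtr_sqr ler_wsqrtr //.
apply: le_trans h1; rewrite /dotmul (bigD1 i) //= !mxE -expr2 lerDl.
by apply: sumr_ge0 => j _; rewrite -expr2 sqr_ge0.
Qed.

Lemma lebesgue_ball_gt0 d :
  (0 < lebesgue_rV [set z : 'rV[R]_d.+1 | (dotmul z z <= 1)%R])%E.
Proof.
have h : (0 : R) <= d.+1%:R^-1 by rewrite invr_ge0.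
have [mS E] := tuple_measure_box d.+1 h.
(* The ball contains the cube of side [d.+1%:R^-1] with a corner at the origin. *)
apply: (@lt_le_trans _ _ (mu d.+1 [set t | forall i, 0 <= tnth t i <= d.+1%:R^-1])).
  by rewrite E lte_fin exprn_gt0 // subr0 invr_gt0.
apply: le_measure; rewrite ?inE //; first exact: ball_rmeasurable.
move=> t /= h1; rewrite /dotmul.
apply: (@le_trans _ _ (\sum_(i < d.+1) (d.+1%:R^-1 : R))); last first.
  by rewrite sumr_const card_ord -[X in X <= _]mulr_natl mulfV.
apply: ler_sum => i _; rewrite mxE; have /andP[a b] := h1 i.
have c : (d.+1%:R^-1 : R) <= 1 by rewrite invf_le1 // ler1n.
by apply: le_trans (ler_pM a a b b) _; rewrite -[leRHS]mulr1 ler_wpM2l.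
Qed.

End ball.

(** * The normalized measure of caps *)

Section volume.
Context (R : realType) (d : nat).
Local Notation leb := (@lebesgue_measure R).
Local Notation mu := (tuple_measure leb).
Implicit Types (x y z : 'rV[R]_d.+1) (A B : set 'rV[R]_d.+1).

Definition ball1 : set 'rV[R]_d.+1 := [set z | dotmul z z <= 1].

Definition vol A : R := fine (lebesgue_rV A).

(** For [t = cos phi] this is the cone over the cap of angle [phi] around [x], see [cone_cap]. The
    factor [enorm z] makes the second condition invariant under positive scaling. *)
Definition capcone (t : R) x : set 'rV[R]_d.+1 :=
  [set z | dotmul z z <= 1 /\ t * enorm z <= dotmul z x].

Lemma rmeasurable_ball1 : rmeasurable ball1. Proof. exact: ball_rmeasurable. Qed.

Lemma rmeasurableI A B : rmeasurable A -> rmeasurable B -> rmeasurable (A `&` B).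
Proof. by move=> mA mB; rewrite /rmeasurable preimage_setI; exact: measurableI. Qed.

Lemma rmeasurableC A : rmeasurable A -> rmeasurable (~` A).
Proof. by move=> mA; rewrite /rmeasurable preimage_setC; exact: measurableC. Qed.

Lemma measurable_enorm : measurable_fun setT (@enorm R d.+1 \o @rowt R d.+1).
Proof.
have md := measurable_dotmul (@rmeasurable_rowt R d.+1) (@rmeasurable_rowt R d.+1).
apply: (@measurableT_comp _ _ _ _ _ _ (@Num.sqrt R)) md.
by apply: continuous_measurable_fun; exact: sqrt_continuous.
Qed.

Lemma rmeasurable_capcone t x : rmeasurable (capcone t x).
Proof.
apply: rmeasurableI; first exact: rmeasurable_ball1.
apply: rmeasurable_le.
  exact: measurable_funM (measurable_cst t) measurable_enorm.
exact: measurable_dotmul (@rmeasurable_rowt R d.+1) (rmeasurable_cst x).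
Qed.

Lemma ball1_fin A : rmeasurable A -> A `<=` ball1 -> lebesgue_rV A \is a fin_num.
Proof.
move=> mA AB; rewrite ge0_fin_numE ?measure_ge0 //.
apply: (le_lt_trans (lebesgue_rV_le mA rmeasurable_ball1 AB)).
by rewrite -ge0_fin_numE ?measure_ge0 //; exact: lebesgue_ball_fin.
Qed.

Lemma volE A : rmeasurable A -> A `<=` ball1 -> lebesgue_rV A = (vol A)%:E.
Proof. by move=> mA AB; rewrite fineK // ball1_fin. Qed.

Lemma vol_ge0 A : 0 <= vol A.
Proof. by apply: fine_ge0; exact: measure_ge0. Qed.

Lemma vol_ball1_gt0 : 0 < vol ball1.
Proof. by rewrite -lte_fin -volE //; [exact: lebesgue_ball_gt0|exact: rmeasurable_ball1]. Qed.

Lemma vol_le A B : rmeasurable A -> rmeasurable B -> A `<=` B -> B `<=` ball1 ->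
  vol A <= vol B.
Proof.
move=> mA mB AB Bb; rewrite -lee_fin -!volE //; first exact: lebesgue_rV_le.
exact: subset_trans Bb.
Qed.

Lemma vol_affine_le s (v : 'rV[R]_d.+1) A B : 0 < s -> rmeasurable A -> rmeasurable B ->
  A `<=` ball1 -> B `<=` ball1 -> (forall z, A z -> B (s *: z + v)) ->
  s ^+ d.+1 * vol A <= vol B.
Proof.
move=> s0 mA mB Ab Bb AB; rewrite mulrC -ler_pdivlMr ?exprn_gt0 // mulrC.
rewrite -lee_fin EFinM -!volE // -(lebesgue_rV_affine v) //.
apply: lebesgue_rV_le => //.
apply: (rmeasurable_preimage (g := fun t => s *: rowt t + v)) mB.
apply: rmeasurable_funD; last exact: rmeasurable_cst.
apply: rmeasurable_funZ; [exact: measurable_cst|exact: rmeasurable_rowt].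
Qed.

Lemma vol_split A B : rmeasurable A -> rmeasurable B -> A `<=` ball1 ->
  vol A = vol (A `&` B) + vol (A `&` ~` B).
Proof.
move=> mA mB Ab; apply: EFin_inj; rewrite EFinD.
have mAB : rmeasurable (A `&` B) by exact: rmeasurableI.
have mAB' : rmeasurable (A `&` ~` B) by apply: rmeasurableI => //; exact: rmeasurableC.
rewrite -!volE //; [|by move=> z [/Ab]..].
by rewrite addeC -setDE; exact: measureDI.
Qed.

Lemma capcone_ball1 t x : capcone t x `<=` ball1. Proof. by move=> z []. Qed.

Definition pole : 'rV[R]_d.+1 := delta_mx 0 0.

Lemma dotmul_pole : dotmul pole pole = 1.
Proof.
rewrite /dotmul (bigD1 ord0) //= !mxE !eqxx mulr1 big1 ?addr0 // => i i0.
by rewrite !mxE (negbTE i0) mulr0.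
Qed.

(** The function f of the overview: [sigma_cap] identifies it with the normalized measure of a cap,
    as a function of the cosine of its angle. *)
Definition capf (t : R) : R := vol (capcone t pole) / vol ball1.

(** The reflection exchanging [pole] and [x] preserves volume, the unit ball serving as the
    invariant set. *)
Lemma vol_capcone t x : dotmul x x = 1 -> vol (capcone t x) = capf t * vol ball1.
Proof.
move=> x1; rewrite /capf mulfVK ?gt_eqF ?vol_ball1_gt0 // /vol; congr fine.
pose U := refl (pole - x); have Upole : U pole = x by apply: refl_unit dotmul_pole x1.
have Ux : U x = pole by rewrite -Upole /U reflK.
rewrite -(@lebesgue_rV_isometry R d.+1 U (capcone t pole) ball1); last 8 first.
- exact: reflD.
- exact: reflK.
- apply: rmeasurable_funD (@rmeasurable_rowt _ _) _.
  apply: rmeasurable_funN; apply: rmeasurable_funZ (rmeasurable_cst _).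
  apply: measurable_funM (measurable_cst _).
  apply: measurable_funM; first exact: measurable_cst.
  exact: measurable_dotmul (rmeasurable_cst _) (@rmeasurable_rowt _ _).
- by move=> z; rewrite /ball1 /= dotmulNl dotmulNr opprK dotmul_refl.
- exact: rmeasurable_capcone.
- exact: rmeasurable_ball1.
- exact: lebesgue_ball_fin.
- by rewrite gt_eqF // lebesgue_ball_gt0.
congr lebesgue_rV; apply/seteqP; split => z; rewrite /capcone /= /enorm.
  by rewrite dotmul_refl -Ux dotmul_refl.
by rewrite -[in X in _ -> X](dotmul_refl (pole - x) z x) -/U Ux dotmul_refl.
Qed.

Lemma capf_ge0 t : 0 <= capf t.
Proof. by rewrite divr_ge0 ?vol_ge0. Qed.

Lemma capf_le1 t : capf t <= 1.
Proof.
rewrite ler_pdivrMr ?vol_ball1_gt0 // mul1r.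
by apply: vol_le => //; [exact: rmeasurable_capcone|exact: rmeasurable_ball1|exact: capcone_ball1].
Qed.

Lemma capf_antitone t t' : t <= t' -> capf t' <= capf t.
Proof.
move=> tt'; rewrite ler_pM2r ?invr_gt0 ?vol_ball1_gt0 //.
apply: vol_le; [exact: rmeasurable_capcone..| |exact: capcone_ball1].
move=> z [z1 h]; split => //; apply: le_trans h.
by rewrite ler_wpM2r ?enorm_ge0.
Qed.

Lemma enorm_le1 z : (enorm z <= 1) = (dotmul z z <= 1).
Proof. by rewrite -sqr_enorm expr_le1 ?enorm_ge0. Qed.

Lemma enorm1 x : dotmul x x = 1 -> enorm x = 1.
Proof. by rewrite /enorm => ->; rewrite sqrtr1. Qed.

(* The homothety towards [pole] of ratio [b] maps the cone over the cap of
   height [u] into the cone over the cap of height [b * u]. *)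
Lemma capf_contract b u : 0 < b <= 1 -> 0 <= u <= 1 ->
  b ^+ d.+1 * capf (1 - u) <= capf (1 - b * u).
Proof.
move=> /andP[b0 b1] /andP[u0 u1].
rewrite /capf mulrA ler_pM2r ?invr_gt0 ?vol_ball1_gt0 //.
apply: (vol_affine_le (v := (1 - b) *: pole)) => //;
  [exact: rmeasurable_capcone|exact: rmeasurable_capcone|exact: capcone_ball1
  |exact: capcone_ball1|].
move=> z [z1 zp].
have nz : enorm z <= 1 by rewrite enorm_le1.
have nz0 := enorm_ge0 z.
have nw : enorm (b *: z + (1 - b) *: pole) <= b * enorm z + (1 - b).
  apply: le_trans (enormD _ _) _; rewrite !enormZ (enorm1 dotmul_pole).
  by rewrite !ger0_norm; lra.
split; first by rewrite -enorm_le1; nra.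
rewrite dotmulDl !dotmulZl dotmul_pole.
have h : (1 - b * u) * enorm (b *: z + (1 - b) *: pole) <= (1 - b * u) * (b * enorm z + (1 - b)).
  by rewrite ler_wpM2l //; nra.
apply: le_trans h _.
have h1 : 0 <= b * (1 - b) * u * (1 - enorm z).
  by rewrite !mulr_ge0 //; lra.
nra.
Qed.

(* Points of the cone over [capf t] outside the cone over [capf (t + k)] are
   pushed into the latter by the translation by [4 * k *: pole], which increases
   their norm little since they are nearly orthogonal to [pole]. *)
Lemma capf_step t k : 0 <= t -> 0 <= k -> t + k <= 3 / 4 ->
  capf t <= (1 + Num.sqrt (1 + 8 * k * (t + k) + 16 * k ^+ 2) ^+ d.+1) * capf (t + k).
Proof.
move=> t0 k0 tk.
have mc s : rmeasurable (capcone s pole) by exact: rmeasurable_capcone.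
rewrite /capf mulrA ler_pM2r ?invr_gt0 ?vol_ball1_gt0 //.
rewrite (vol_split (B := capcone (t + k) pole)) //; last exact: capcone_ball1.
rewrite mulrDl mul1r lerD //.
  by apply: vol_le => //; [exact: rmeasurableI|exact: capcone_ball1].
set r := Num.sqrt _; have r2 : r ^+ 2 = 1 + 8 * k * (t + k) + 16 * k ^+ 2.
  by rewrite sqr_sqrtr //; nra.
have r0 : 0 < r by rewrite sqrtr_gt0; nra.
rewrite mulrC -ler_pdivrMr ?exprn_gt0 // mulrC -exprVn.
apply: (vol_affine_le (v := r^-1 *: ((4 * k) *: pole))) => //.
- by rewrite invr_gt0.
- by apply: rmeasurableI => //; exact: rmeasurableC.
- by move=> z [] /capcone_ball1.
- exact: capcone_ball1.
move=> z [[z1 zp] nz]; have {nz}zp' : dotmul z pole < (t + k) * enorm z.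
  by rewrite ltNge; apply/negP => h; apply: nz.
have nz : enorm z <= 1 by rewrite enorm_le1.
have nz0 := enorm_ge0 z.
rewrite -scalerDr; set w := z + _.
have ww : dotmul w w = dotmul z z + 8 * k * dotmul z pole + 16 * k ^+ 2.
  rewrite /w !(dotmulDl, dotmulDr, dotmulZl, dotmulZr) dotmul_pole.
  by rewrite (dotmulC pole z); ring.
split.
  rewrite dotmulZl dotmulZr mulrA -expr2 exprVn mulrC ler_pdivrMr ?exprn_gt0 // mul1r.
  rewrite r2 ww.
  have : dotmul z pole <= t + k by nra.
  move=> h; have : k * dotmul z pole <= k * (t + k) by rewrite ler_wpM2l.
  lra.
rewrite enormZ dotmulZl ger0_norm ?invr_ge0 ?(ltW r0) // mulrCA ler_pM2l ?invr_gt0 //.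
rewrite /w dotmulDl dotmulZl dotmul_pole mulr1.
have nw : enorm w <= enorm z + 4 * k.
  apply: le_trans (enormD _ _) _; rewrite enormZ (enorm1 dotmul_pole).
  by rewrite ger0_norm; lra.
have h : (t + k) * enorm w <= (t + k) * (enorm z + 4 * k) by rewrite ler_wpM2l //; lra.
apply: le_trans h _.
have : 0 <= k * (4 * (1 - t - k) - enorm z) by rewrite mulr_ge0 //; lra.
nra.
Qed.

(** The cone over the cap lies in the ball of radius [sqrt (1 - c ^+ 2)] centred at [c *: pole]. *)
Lemma capf_le_sqrt c : 0 <= c -> c ^+ 2 <= 2^-1 ->
  capf c <= Num.sqrt (1 - c ^+ 2) ^+ d.+1.
Proof.
move=> c0 c2; rewrite ler_pdivrMr ?vol_ball1_gt0 //.
set r := Num.sqrt _.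
have r2 : r ^+ 2 = 1 - c ^+ 2 by rewrite sqr_sqrtr //; lra.
have r0 : 0 < r by rewrite sqrtr_gt0; lra.
rewrite mulrC -ler_pdivrMr ?exprn_gt0 // mulrC -exprVn.
apply: (vol_affine_le (v := r^-1 *: (- c *: pole))) => //.
- by rewrite invr_gt0.
- exact: rmeasurable_capcone.
- exact: rmeasurable_ball1.
- exact: capcone_ball1.
move=> z [z1 zp].
have nz : enorm z <= 1 by rewrite enorm_le1.
have nz0 := enorm_ge0 z.
rewrite -scalerDr /ball1 /= dotmulZl dotmulZr mulrA -expr2 exprVn mulrC.
rewrite ler_pdivrMr ?exprn_gt0 // mul1r r2.
rewrite !(dotmulDl, dotmulDr, dotmulZl, dotmulZr) dotmul_pole (dotmulC pole z).
rewrite -sqr_enorm.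
have : c * (c * enorm z) <= c * dotmul z pole by rewrite ler_wpM2l.
have : 0 <= (1 - enorm z) * (1 + enorm z - 2 * c ^+ 2).
  rewrite mulr_ge0 //; lra.
nra.
Qed.

End volume.

(** * Averages over the sphere and dispersion *)

Section average.
Context (R : realType) (d : nat).
Implicit Types (x y z : 'rV[R]_d.+1) (E : set 'rV[R]_d.+1).

Lemma vol_average (I : Type) (s : seq I) (a : I -> R) (A : I -> 'rV[R]_d.+1 -> bool) E :
  (forall i, rmeasurable [set z | A i z]) -> rmeasurable E -> E `<=` @ball1 R d ->
  0 < vol E ->
  exists2 z, E z & (\sum_(i <- s) a i * (A i z)%:R) * vol E <=
                   \sum_(i <- s) a i * vol (E `&` [set z | A i z]).
Proof.
move=> mA; elim: s E => [|i s IH] E mE Eb E0.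
  have [z Ez] : E !=set0.
    apply/set0P/eqP => E00; move: E0; rewrite E00 /vol /lebesgue_rV.
    by rewrite (_ : mkset _ = set0) ?measure0 ?ltxx //; apply/seteqP; split.
  by exists z => //; rewrite !big_nil mul0r.
pose E1 := E `&` [set z | A i z]; pose E2 := E `&` ~` [set z | A i z].
have mE1 : rmeasurable E1 by exact: rmeasurableI.
have mE2 : rmeasurable E2 by apply: rmeasurableI => //; exact: rmeasurableC.
have E1b : E1 `<=` @ball1 R d by move=> z [/Eb].
have E2b : E2 `<=` @ball1 R d by move=> z [/Eb].
have v12 : vol E = vol E1 + vol E2 by exact: vol_split.
pose S F := \sum_(k <- s) a k * vol (F `&` [set z | A k z]).
have SE : S E = S E1 + S E2.
  rewrite /S -big_split; apply: eq_bigr => k _ /=; rewrite -mulrDr; congr (_ * _).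
  rewrite (vol_split (B := [set z | A i z])) //; last 2 first.
  - exact: rmeasurableI.
  - by move=> z [/Eb].
  by rewrite /E1 /E2 !(setIAC E _ [set z | A k z]).
have S0 F : rmeasurable F -> F `<=` @ball1 R d -> vol F = 0 -> S F = 0.
  move=> mF Fb F0; rewrite /S big1 // => k _.
  suff -> : vol (F `&` [set z | A k z]) = 0 by rewrite mulr0.
  apply/eqP; rewrite eq_le vol_ge0 andbT -F0.
  by apply: vol_le => //; exact: rmeasurableI.
pose t z := \sum_(k <- s) a k * (A k z)%:R.
have goal1 z : E1 z -> (a i + t z) * vol E <= a i * vol E1 + S E ->
    exists2 z, E z & (\sum_(i <- (i :: s)) a i * (A i z)%:R) * vol E <=
                   \sum_(i <- (i :: s)) a i * vol (E `&` [set z | A i z]).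
  by move=> [Ez /= Az] h; exists z => //; rewrite !big_cons Az mulr1.
have goal2 z : E2 z -> t z * vol E <= a i * vol E1 + S E ->
    exists2 z, E z & (\sum_(i <- (i :: s)) a i * (A i z)%:R) * vol E <=
                   \sum_(i <- (i :: s)) a i * vol (E `&` [set z | A i z]).
  by move=> [Ez /= /negP/negbTE Az] h; exists z => //; rewrite !big_cons Az mulr0 add0r.
have [v1|v1] := eqVneq (vol E1) 0.
  have v2 : 0 < vol E2 by move: E0; rewrite v12 v1 add0r.
  have [z E2z tz] := IH E2 mE2 E2b v2.
  by apply: (goal2 z E2z); rewrite SE v12 v1 (S0 E1) // mulr0 !add0r.
have {}v1 : 0 < vol E1 by rewrite lt_def v1 vol_ge0.
have [z1 E1z tz1] := IH E1 mE1 E1b v1.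
have [v2|v2] := eqVneq (vol E2) 0.
  apply: (goal1 z1 E1z); rewrite SE v12 v2 (S0 E2) // !addr0 mulrDl lerD2l.
  exact: tz1.
have {}v2 : 0 < vol E2 by rewrite lt_def v2 vol_ge0.
have [z2 E2z tz2] := IH E2 mE2 E2b v2.
have {}tz1 : t z1 * vol E1 <= S E1 by exact: tz1.
have {}tz2 : t z2 * vol E2 <= S E2 by exact: tz2.
(* The mean over [E] is a convex combination of those over [E1] and [E2], so the smaller of the two
   values found is good enough. *)
have [t12|t21] := leP (a i + t z1) (t z2).
  by apply: (goal1 z1 E1z); rewrite SE v12; nra.
by apply: (goal2 z2 E2z); rewrite SE v12; nra.
Qed.

Lemma rmeasurable_origin : rmeasurable [set 0 : 'rV[R]_d.+1].
Proof.
rewrite (_ : [set 0] = [set z | enorm z <= 0]).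
  by apply: rmeasurable_le; [exact: measurable_enorm|exact: measurable_cst].
apply/seteqP; split => z /=.
  by move=> ->; rewrite le_eqVlt enorm_eq0 eqxx.
by rewrite le_eqVlt ltNge enorm_ge0 orbF enorm_eq0 => /eqP.
Qed.

(** The origin is fixed by the homothety of ratio 2, which multiplies volumes by [2 ^+ d.+1]. *)
Lemma vol_origin : vol [set 0 : 'rV[R]_d.+1] = 0.
Proof.
have m0 := rmeasurable_origin.
have b0 : [set 0 : 'rV[R]_d.+1] `<=` @ball1 R d.
  by move=> z ->; rewrite /ball1 /= -(scale0r 0) dotmulZl mul0r.
have := @vol_affine_le R d 2 0 [set 0] [set 0] (ltr0Sn R 1) m0 m0 b0 b0.
have h z : [set 0 : 'rV[R]_d.+1] z -> [set 0] (2 *: z + 0).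
  by move=> ->; rewrite /= scaler0 addr0.
move=> /(_ h); rewrite -subr_le0 -{2}[vol _]mul1r -mulrBl pmulr_rle0.
  by move=> v0; apply/eqP; rewrite eq_le v0 vol_ge0.
by rewrite subr_gt0 exprn_egt1 // ltr1n.
Qed.

(** The point found by [vol_average] in the ball is normalized, which does not affect its membership
    in cones; the origin, a null set, is removed beforehand because it has no direction. *)
Lemma capf_average (I : Type) (s : seq I) (a t : I -> R) (y : I -> 'rV[R]_d.+1) :
  (forall i, dotmul (y i) (y i) = 1) ->
  exists2 z, dotmul z z = 1 & \sum_(i <- s) a i * (t i <= dotmul z (y i))%R%:R <=
                   \sum_(i <- s) a i * capf d (t i).
Proof.
move=> y1; pose E := @ball1 R d `&` ~` [set 0].
have m0 := rmeasurable_origin.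
have v0 F : rmeasurable F -> F `<=` @ball1 R d -> vol (F `&` ~` [set 0]) = vol F.
  move=> mF Fb; rewrite [RHS](vol_split (B := [set 0])) //.
  suff -> : vol (F `&` [set 0]) = 0 by rewrite add0r.
  apply/eqP; rewrite eq_le vol_ge0 andbT -vol_origin.
  apply: vol_le => //; [exact: rmeasurableI|].
  by move=> z ->; rewrite /ball1 /= -(scale0r 0) dotmulZl mul0r.
pose A i (z : 'rV[R]_d.+1) := t i * enorm z <= dotmul z (y i).
have mA i : rmeasurable [set z | A i z].
  apply: rmeasurable_le.
    exact: measurable_funM (measurable_cst _) (@measurable_enorm R d).
  exact: measurable_dotmul (@rmeasurable_rowt R _) (rmeasurable_cst _).
have mb := @rmeasurable_ball1 R d.
have mE : rmeasurable E by apply: rmeasurableI => //; exact: rmeasurableC.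
have Eb : E `<=` @ball1 R d by exact: subIsetl.
have vE : vol E = vol (@ball1 R d) by exact: v0.
have E0 : 0 < vol E by rewrite vE vol_ball1_gt0.
have [z [z1 /eqP z0] h] := vol_average s a mA mE Eb E0.
have nz : 0 < enorm z by rewrite enorm_gt0.
exists ((enorm z)^-1 *: z).
  by rewrite dotmulZl dotmulZr -sqr_enorm; field; rewrite gt_eqF.
rewrite -(ler_pM2r E0).
have <- : \sum_(i <- s) a i * vol (E `&` [set z | A i z]) =
          (\sum_(i <- s) a i * capf d (t i)) * vol E.
  rewrite mulr_suml; apply: eq_bigr => i _; rewrite -mulrA vE -(vol_capcone _ (y1 i)).
  congr (_ * _); rewrite -[RHS]v0; last 2 first.
  - exact: rmeasurable_capcone.
  - exact: capcone_ball1.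
  by rewrite /E setIAC.
apply: le_trans h; rewrite le_eqVlt; apply/orP; left; apply/eqP; congr (_ * _).
apply: eq_bigr => i _; congr (_ * _); rewrite dotmulZl mulrC ler_pdivlMr //.
Qed.

End average.

(** * From coverings of the sphere to dispersion *)

Section dispersion.
Context (R : realType) (d : nat).
Implicit Types (x y z : 'rV[R]_d.+1).

Lemma dotmul_itv x y : dotmul x x = 1 -> dotmul y y = 1 -> -1 <= dotmul x y <= 1.
Proof.
move=> x1 y1; have := dotmul_le x y; have := dotmul_le (- x) y.
by rewrite dotmulNl enormN !enorm1 // mulr1 => h1 h2; apply/andP; split; lra.
Qed.

Lemma le_acos (u phi : R) : -1 <= u <= 1 -> 0 <= phi <= pi ->
  (acos u <= phi) = (cos phi <= u).
Proof.
move=> u1 p1; rewrite leNgt -[u in RHS]acosK; last by rewrite in_itv.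
rewrite -ltr_cos ?in_itv //=; last by rewrite acos_ge0 // acos_lepi.
by rewrite -leNgt acosK ?in_itv.
Qed.

Lemma cone_sphere : cone (@sphere R d) = @ball1 R d.
Proof.
apply/seteqP; split => [z [t [x x1 [/andP[t0 t1] ->]]]|z z1].
  rewrite /ball1 /= dotmulZl dotmulZr x1; nra.
have [->|z0] := eqVneq z 0.
  by exists 0, (pole R d); [exact: dotmul_pole|rewrite scale0r lexx ler01].
have nz : 0 < enorm z by rewrite enorm_gt0.
exists (enorm z), ((enorm z)^-1 *: z).
  by rewrite /sphere /= dotmulZl dotmulZr -sqr_enorm; field; rewrite gt_eqF.
by rewrite enorm_ge0 enorm_le1 z1 scalerA mulfV ?scale1r ?gt_eqF.
Qed.

Lemma cone_cap x phi : dotmul x x = 1 -> 0 <= phi <= pi ->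
  cone (cap x phi) = capcone (cos phi) x.
Proof.
move=> x1 p1; apply/seteqP; split => [z [t [y [y1 yx] [/andP[t0 t1] ->]]]|z [z1 zx]].
  move: yx; rewrite le_acos ?dotmul_itv // => yx.
  split; first by rewrite dotmulZl dotmulZr y1; nra.
  rewrite enormZ dotmulZl (enorm1 y1) mulr1 ger0_norm // mulrC (dotmulC y).
  by rewrite ler_wpM2l.
have [->|z0] := eqVneq z 0.
  exists 0, x; last by rewrite scale0r lexx ler01.
  by split => //; rewrite x1 acos1; case/andP: p1.
have nz : 0 < enorm z by rewrite enorm_gt0.
exists (enorm z), ((enorm z)^-1 *: z); last first.
  by rewrite enorm_ge0 enorm_le1 z1 scalerA mulfV ?scale1r ?gt_eqF.
have y1 : dotmul ((enorm z)^-1 *: z) ((enorm z)^-1 *: z) = 1.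
  by rewrite /sphere /= dotmulZl dotmulZr -sqr_enorm; field; rewrite gt_eqF.
split => //; rewrite le_acos ?dotmul_itv // dotmulZr mulrC ler_pdivlMr //.
by rewrite dotmulC.
Qed.

Lemma sigma_cap x phi : dotmul x x = 1 -> 0 <= phi <= pi ->
  sigma (cap x phi) = (capf d (cos phi))%:E.
Proof.
move=> x1 p1; rewrite /sigma cone_cap // cone_sphere.
rewrite !volE //; [|exact: rmeasurable_ball1|exact: rmeasurable_capcone|exact: capcone_ball1].
rewrite inver gt_eqF ?vol_ball1_gt0 // -EFinM vol_capcone // mulfK //.
by rewrite gt_eqF ?vol_ball1_gt0.
Qed.

(** Duality: an empty cap around [x] misses some [z] with [c <= dotmul z x], so the cosine of its
    angle is above [c]. *)
Lemma disp_le_capf n c (s : seq 'rV[R]_d.+1) : (size s <= n)%N ->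
  {in s, forall z, dotmul z z = 1} ->
  (forall x, dotmul x x = 1 -> exists2 z, z \in s & c <= dotmul z x) ->
  (disp R n d <= (capf d c)%:E)%E.
Proof.
(* If [s] has fewer than [n] points, the default [pole] of [nth] fills the remaining places. *)
move=> sn s1 cov; pose X (i : 'I_n) := nth (pole R d) s i.
apply: (@le_trans _ _ (ereal_sup [set sigma A | A in
   [set A | @caps R d A /\ A `&` range X = set0]])).
  apply: ereal_inf_lbound; exists X => // i; rewrite /X.
  have [i_lt|i_ge] := ltnP i (size s); first by apply: s1; exact: mem_nth.
  by rewrite nth_default //; exact: dotmul_pole.
apply: ub_ereal_sup => _ [_ [[x [phi [x1 p1 ->]]] E] <-].
rewrite sigma_cap // lee_fin; apply: capf_antitone.
have [z zs cz] := cov x x1.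
rewrite leNgt; apply/negP => pc.
have : (cap x phi `&` range X) z; last by rewrite E.
split.
  split; first exact: s1.
  rewrite (le_acos (dotmul_itv x1 (s1 z zs)) p1) (dotmulC x).
  exact: le_trans (ltW pc) cz.
have zn : (index z s < n)%N by rewrite (leq_trans _ sn) // index_mem.
by exists (Ordinal zn) => //; rewrite /X /= nth_index.
Qed.

Lemma disp_le1 n : (0 < n)%N -> (disp R n d <= 1)%E.
Proof.
move=> n0; apply: (@le_trans _ _ (capf d (-1 : R))%:E); last by rewrite lee_fin capf_le1.
apply: (@disp_le_capf n (-1) [:: pole R d]) => //.
  by move=> z; rewrite inE => /eqP ->; exact: dotmul_pole.
move=> x x1; exists (pole R d); rewrite ?inE //.
by have /andP[] := dotmul_itv (dotmul_pole R d) x1.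
Qed.

End dispersion.

(** * Greedy choices *)

Section greedy.
Context (R : realType) (d : nat).
Implicit Types (x y z : 'rV[R]_d.+1).

Lemma bernoulli (x : R) n : -1 <= x -> 1 + n%:R * x <= (1 + x) ^+ n.
Proof.
move=> x1; elim: n => [|n IH]; first by rewrite mul0r addr0 expr0.
rewrite exprS; have : (1 + x) * (1 + n%:R * x) <= (1 + x) * (1 + x) ^+ n.
  by rewrite ler_wpM2l //; lra.
apply: le_trans; rewrite -natr1.
have : 0 <= n%:R * x ^+ 2 by rewrite mulr_ge0 // sqr_ge0.
nra.
Qed.

(** Chordal distances bring in the triangle inequality. *)
Lemma chord x y (r : R) : dotmul x x = 1 -> dotmul y y = 1 -> 0 <= r ->
  (1 - r ^+ 2 / 2 <= dotmul x y) = (enorm (x - y) <= r).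
Proof.
move=> x1 y1 r0; rewrite -[RHS](ler_pXn2r (ltn0Sn 1)) ?nnegrE ?enorm_ge0 //.
rewrite sqr_enorm !(dotmulBl, dotmulBr) x1 y1 (dotmulC y x).
by apply/idP/idP => h; lra.
Qed.

(** Two opposite hemispheres cover the sphere. *)
Lemma capf0_ge : 2^-1 <= capf d (0 : R).
Proof.
pose y (b : bool) : 'rV[R]_d.+1 := if b then pole R d else - pole R d.
have y1 b : dotmul (y b) (y b) = 1.
  by case: b; rewrite /y ?dotmulNl ?dotmulNr ?opprK dotmul_pole.
have [z _] := capf_average [:: true; false] (fun=> 1) (fun=> 0) y1.
rewrite !big_cons !big_nil !mul1r !addr0 /y dotmulNr oppr_ge0.
set v := dotmul z _; case: (leP 0 v) => v0; first by case: (v <= 0) => /=; lra.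
by rewrite (ltW v0) /=; lra.
Qed.

(** The caps of chordal radius [r] around [Y] are disjoint. Weights -1 in [capf_average] give a
    point lying in at least the mean number of them, and it lies in at most one. *)
Lemma capf_packing (Y : seq 'rV[R]_d.+1) (r : R) : 0 <= r ->
  {in Y, forall y, dotmul y y = 1} ->
  pairwise (fun x y => 2 * r < enorm (x - y)) Y ->
  (size Y)%:R * capf d (1 - r ^+ 2 / 2) <= 1.
Proof.
move=> r0 Y1 sep.
pose y (i : 'I_(size Y)) := nth 0 Y i.
have y1 i : dotmul (y i) (y i) = 1 by apply: Y1; exact: mem_nth.
have [z z1] := capf_average (index_enum 'I_(size Y)) (fun=> -1) (fun=> 1 - r ^+ 2 / 2) y1.
move: (capf d _) => f; rewrite -!mulr_sumr !mulN1r lerN2 sumr_const card_ord -[_ *+ _]mulr_natl.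
move=> /le_trans; apply.
under eq_bigr => i _ do rewrite chord //.
have [[i iz]|none] := pselect (exists i, enorm (z - y i) <= r); last first.
  rewrite big1 // => i _; case: leP => // h; exfalso; apply: none; by exists i.
rewrite (bigD1 i) //= iz big1 ?addr0 // => j ji.
case: leP => // jz; exfalso.
have ij : 2 * r < enorm (y i - y j).
  move/(pairwiseP 0) : sep => sep.
  have [ltij|ltji|/val_inj eij] := ltngtP i j; last by rewrite eij eqxx in ji.
    by apply: sep; rewrite ?inE.
  by rewrite enormB; apply: sep; rewrite ?inE.
have : enorm (y i - y j) <= enorm (y i - z) + enorm (z - y j).
  by rewrite (_ : y i - y j = (y i - z) + (z - y j)) ?enormD // addrA subrK.
rewrite (enormB (y i) z); lra.
Qed.

(* Two disjoint caps of height [u / 16], centred at the points [a *: pole +- b *: e]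
   at chordal distance [3/4 * sqrt (2 * u)] from [pole], fit into the larger cap. *)
Lemma capf_halve (u : R) : (0 < d)%N -> 0 < u <= 1 ->
  2 * capf d (1 - u / 16) <= capf d (1 - u).
Proof.
move=> d0 /andP[u0 u1].
pose e : 'rV[R]_d.+1 := delta_mx 0 (inord 1).
have e1 : dotmul e e = 1.
  rewrite /dotmul (bigD1 (inord 1)) //= !mxE !eqxx mulr1 big1 ?addr0 // => i i0.
  by rewrite !mxE (negbTE i0) mulr0.
have ep : dotmul e (pole R d) = 0.
  rewrite /dotmul big1 // => i _; rewrite !mxE /=.
  have [->|i0] := eqVneq i ord0; last by rewrite mulr0.
  have -> : (ord0 == inord 1 :> 'I_d.+1) = false by rewrite -val_eqE /= inordK.
  by rewrite mul0r.
pose a : R := 1 - 9 * u / 16.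
pose b := Num.sqrt (1 - a ^+ 2).
have b2 : b ^+ 2 = 1 - a ^+ 2 by rewrite sqr_sqrtr // /a; nra.
have bb : b * b = 1 - a * a by rewrite -!expr2.
have aE : a = 1 - 9 * u / 16 by [].
pose y (i : 'I_3) : 'rV[R]_d.+1 := if i == ord0 then pole R d else
  a *: pole R d + (if (i : nat) == 2%N then b else - b) *: e.
have y1 i : dotmul (y i) (y i) = 1.
  rewrite /y; case: ifP => _; first exact: dotmul_pole.
  rewrite !(dotmulDl, dotmulDr, dotmulZl, dotmulZr) (dotmulC _ e) ep e1 dotmul_pole.
  by case: ifP => _; nra.
pose r := Num.sqrt (2 * u).
have r2 : r ^+ 2 = 2 * u by rewrite sqr_sqrtr //; lra.
have r0 : 0 < r by rewrite sqrtr_gt0; lra.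
pose t (i : 'I_3) := if i == ord0 then 1 - u else 1 - u / 16.
(* With weights 1, -1, -1 the sum of indicators is nonnegative everywhere, since the small caps are
   disjoint and contained in the large one. *)
have [z z1] := capf_average (index_enum 'I_3)
  (fun i => if i == ord0 then 1 else -1) t y1.
rewrite !big_ord_recl !big_ord0 /t /= !addr0 !mul1r !mulN1r.
set y2 := y (lift ord0 ord0); set y3 := y (lift ord0 (lift ord0 ord0)).
have ty i : i != ord0 -> enorm (y i - pole R d) = 3 / 4 * r.
  move=> i0; apply/eqP; rewrite -(eqrXn2 (n := 2)) ?enorm_ge0 //; last by lra.
  rewrite sqr_enorm /y (negbTE i0) exprMn r2.
  rewrite !(dotmulDl, dotmulDr, dotmulZl, dotmulZr, dotmulNl, dotmulNr).
  rewrite (dotmulC _ e) ep e1 dotmul_pole; apply/eqP.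
  by case: ifP => _; lra.
have -> : 1 - u = 1 - r ^+ 2 / 2 by rewrite r2; lra.
have -> : 1 - u / 16 = 1 - (r / 4) ^+ 2 / 2 by rewrite exprMn r2 exprVn; lra.
have r4 : 0 <= r / 4 by lra.
rewrite (chord z1 (y1 _) (ltW r0)) !(chord z1 _ r4) ?y1 //.
have p0 : y ord0 = pole R d by [].
have ny i : i != ord0 -> enorm (z - y i) <= r / 4 -> enorm (z - y ord0) <= r.
  move=> i0 h; have := enormD (z - y i) (y i - pole R d).
  rewrite ty // addrA subrK p0; lra.
have h2 := ny (lift ord0 ord0) isT; have h3 := ny (lift ord0 (lift ord0 ord0)) isT.
have n23 : enorm (z - y2) <= r / 4 -> enorm (z - y3) <= r / 4 -> False.
  move=> {}h2 {}h3; have := enormD (y2 - z) (z - y3).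
  rewrite addrA subrK (enormB y2) => h.
  have : enorm (y2 - y3) <= r / 2 by lra.
  rewrite -(ler_pXn2r (ltn0Sn 1)) ?nnegrE ?enorm_ge0 //; last by lra.
  have -> : y2 - y3 = (- 2 * b) *: e.
    rewrite -[y2]/(a *: pole R d + (- b) *: e) -[y3]/(a *: pole R d + b *: e).
    rewrite opprD addrACA subrr add0r -scalerBl; congr (_ *: _); lra.
  by rewrite sqr_enorm dotmulZl dotmulZr e1 exprMn exprVn r2 => hh; nra.
move: h2 h3 n23; rewrite -/y2 -/y3 /=.
case: (enorm (z - y2) <= r / 4); case: (enorm (z - y3) <= r / 4);
  case: (enorm (z - y ord0) <= r) => //= h2 h3 n23;
  rewrite ?mulr1 ?mulr0 => h; try (by exfalso; exact: n23);
  try (by have := h2 isT); try (by have := h3 isT); lra.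
Qed.

(** A discrete substitute for continuity of [capf]: along [1 - b ^+ k] with [b = 1 - 1 / (2 * D)],
    each step costs at most the factor [b ^+ d.+1 >= 1/2] by [capf_contract], so the first value
    below [p0] is at least [p0 / 2]. *)
Lemma cap_choice (p0 : R) : (0 < d)%N -> 0 < p0 <= 2^-1 ->
  exists c, [/\ 0 <= c < 1, p0 / 2 <= capf d c & capf d c < p0].
Proof.
move=> d0 /andP[p00 p01].
pose D : R := d.+1%:R; have D1 : 1 <= D by rewrite ler1n.
have [x [x0 x1 Dx]] : exists x : R, [/\ 0 < x, x <= 2^-1 & D * x = 2^-1].
  exists (2^-1 / D); split; first by rewrite divr_gt0 ?invr_gt0 //; lra.
    by rewrite ler_pdivrMr; lra.
  by rewrite mulrC mulfVK // gt_eqF //; lra.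
pose b := 1 - x; have bE : b = 1 - x by [].
have b0 : 0 < b by lra.
have b1 : b < 1 by lra.
have bD : 2^-1 <= b ^+ d.+1.
  have h : -1 <= - x by lra.
  by have := bernoulli d.+1 h; rewrite mulrN Dx; apply: le_trans; lra.
have b2D : b ^+ (2 * d.+1) <= 2^-1.
  have h : 2 <= (1 + x) ^+ (2 * d.+1).
    have h : -1 <= x by lra.
    by have := bernoulli (2 * d.+1) h; rewrite natrM -mulrA Dx; apply: le_trans; lra.
  rewrite -(ler_pM2r (ltr0Sn R 1)) mulVf //.
  apply: (@le_trans _ _ (b ^+ (2 * d.+1) * (1 + x) ^+ (2 * d.+1))).
    by rewrite ler_wpM2l // exprn_ge0 // ltW.
  rewrite -exprMn exprn_ile1 //; first by nra.
  by nra.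
have halves k : capf d (1 - (16^-1 : R) ^+ k) <= 2^-1 ^+ k.
  elim: k => [|k IH]; first by rewrite !expr0 capf_le1.
  have k01 : 0 < (16^-1 : R) ^+ k <= 1.
    by rewrite exprn_gt0 //= exprn_ile1 //; lra.
  have := capf_halve d0 k01; rewrite !exprSr; lra.
have ex : exists k, capf d (1 - b ^+ k) < p0.
  have [k hk] : exists k, 2^-1 ^+ k < p0.
    pose m := (Num.truncn p0^-1).+1; exists m.
    have hm : p0^-1 < m%:R by exact: truncnS_gt.
    have : m%:R <= (2 : R) ^+ m.
      have h : -1 <= (1 : R) by lra.
      by have := bernoulli m h; rewrite mulr1; apply: le_trans; lra.
    move=> h; rewrite exprVn invf_plt ?posrE ?exprn_gt0 //.
    exact: lt_le_trans h.
  (* By [b2D], four blocks of [2 * d.+1] factors [b] amount to at most 1/16, the ratio in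
     [halves]. *)
  exists (2 * d.+1 * 4 * k)%N; apply: le_lt_trans hk.
  apply: le_trans (halves k); apply: capf_antitone.
  have b4 : b ^+ (2 * d.+1 * 4) <= 16^-1.
    rewrite exprM (_ : 16^-1 = 2^-1 ^+ 4 :> R); last by field.
    by apply: lerXn2r => //; rewrite nnegrE ?exprn_ge0 ?invr_ge0 ?(ltW b0).
  rewrite lerD2l lerN2 exprM.
  by apply: lerXn2r => //; rewrite nnegrE ?exprn_ge0 ?invr_ge0 ?(ltW b0).
have := ex_minnP ex; case=> -[|k] hk kmin.
  by move: hk; rewrite expr0 subrr => h; have := capf0_ge; lra.
have bk : 0 <= b ^+ k <= 1 by rewrite exprn_ge0 ?exprn_ile1 ?(ltW b0) ?(ltW b1).
have bk0 : 0 < b ^+ k.+1 by rewrite exprn_gt0.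
have bk1 : b ^+ k.+1 <= 1 by rewrite exprn_ile1 ?(ltW b0) ?(ltW b1).
exists (1 - b ^+ k.+1); split => //; first by apply/andP; split; lra.
have hk' : p0 <= capf d (1 - b ^+ k).
  by rewrite leNgt; apply/negP => /kmin; rewrite ltnn.
rewrite exprS; have := @capf_contract R d b (b ^+ k) _ bk.
rewrite b0 (ltW b1) => /(_ isT); apply: le_trans.
rewrite mulrC ler_pM //; lra.
Qed.

(** The current products serve as the weights [w] for the next choice, so every choice multiplies
    the sum by at most [th]. *)
Lemma greedy (I : Type) (Y : seq I) (g : 'rV[R]_d.+1 -> I -> R) (th : R) N :
  (forall z i, 0 <= g z i) -> 0 <= th ->
  (forall w : I -> R, (forall i, 0 <= w i) ->
    exists2 z, dotmul z z = 1 & \sum_(i <- Y) w i * g z i <= th * \sum_(i <- Y) w i) ->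
  exists s : seq 'rV[R]_d.+1, [/\ size s = N, {in s, forall z, dotmul z z = 1} &
    \sum_(i <- Y) \prod_(z <- s) g z i <= th ^+ N * (size Y)%:R].
Proof.
move=> g0 th0 H; elim: N => [|N [s [sN s1 hs]]].
  exists [::]; split => //; rewrite expr0 mul1r.
  under eq_bigr => i _ do rewrite big_nil.
  by rewrite big_const_seq count_predT iter_addr addr0.
have [i|z z1 hz] := H (fun i => \prod_(z <- s) g z i); first by exact: prodr_ge0.
exists (z :: s); split => /=; first by rewrite sN.
  by move=> x; rewrite inE => /orP[/eqP ->|/s1].
under eq_bigr => i _ do rewrite big_cons mulrC.
apply: le_trans hz _; rewrite exprS -mulrA ler_wpM2l //.
Qed.

(** If no separated family were maximal, each could be extended by a point, beyond the size [K]. *)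
Lemma separated_net (Q : 'rV[R]_d.+1 -> Prop) (e : 'rV[R]_d.+1 -> 'rV[R]_d.+1 -> bool) K :
  (forall Y : seq 'rV[R]_d.+1, {in Y, forall y, Q y} -> pairwise e Y -> (size Y <= K)%N) ->
  exists Y : seq 'rV[R]_d.+1, [/\ {in Y, forall y, Q y}, pairwise e Y &
    forall x, Q x -> exists2 y, y \in Y & ~~ e x y].
Proof.
move=> bnd; apply: contrapT => H.
have ext m : exists Y : seq 'rV[R]_d.+1, [/\ {in Y, forall y, Q y}, pairwise e Y & size Y = m].
  elim: m => [|m [Y [YQ Ye Ym]]]; first by exists [::].
  have [x [Qx xY]] : exists x, Q x /\ forall y, y \in Y -> e x y.
    apply: contrapT => none; apply: H; exists Y; split => // x Qx.
    apply: contrapT => h; apply: none; exists x; split => // y yY.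
    by apply: contrapT => /negP h'; apply: h; exists y.
  exists (x :: Y); split => /=; last by rewrite Ym.
    by move=> y; rewrite inE => /orP[/eqP ->|/YQ].
  by rewrite Ye andbT; apply/allP.
have [Y [YQ Ye YK]] := ext K.+1.
by have := bnd Y YQ Ye; rewrite YK ltnn.
Qed.

End greedy.

(** * Covering by small caps *)

Section small_caps.
Context (R : realType) (d : nat).
Implicit Types (x y z : 'rV[R]_d.+1).

Definition covering (c : R) (s : seq 'rV[R]_d.+1) :=
  {in s, forall z, dotmul z z = 1} /\
  forall x, dotmul x x = 1 -> exists2 z, z \in s & c <= dotmul z x.

Lemma exists_covering_log (c : R) : 0 <= c < 1 -> 0 < capf d c ->
  exists2 s, covering c s &
    (size s)%:R <= (4 * d.+1%:R * ln (8 * d.+1%:R) + 1) / capf d c + 1.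
Proof.
move=> /andP[c0 c1]; have p1 := capf_le1 d c; move: p1.
have contract b : 0 < b <= 1 -> b ^+ d.+1 * capf d c <= capf d (1 - b * (1 - c)).
  move=> hb; have h : 0 <= 1 - c <= 1 by apply/andP; split; lra.
  by have := @capf_contract R d b (1 - c) hb h; rewrite subKr.
set p := capf d c in contract * => p1 p0.
have [D [DE D1]] : exists D : R, D = d.+1%:R /\ 1 <= D.
  by exists d.+1%:R; rewrite ler1n.
have D4 : 0 <= 4 * D by lra.
have D8 : 1 <= 8 * D by lra.
rewrite -DE; pose u := 1 - c; pose r := Num.sqrt (2 * u).
have u0 : 0 < u by rewrite /u; lra.
have r2 : r ^+ 2 = 2 * u by rewrite sqr_sqrtr //; lra.
have r0 : 0 < r by rewrite sqrtr_gt0; lra.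
have [v [v0 v1 Dv]] : exists v : R, [/\ 0 < v, v <= 4^-1 & D * v = 4^-1].
  exists (4^-1 / D); split; first by rewrite divr_gt0 ?invr_gt0 //; lra.
    by rewrite ler_pdivrMr; lra.
  by rewrite mulrC mulfVK // gt_eqF //; lra.
pose rho := r * v.
have rho0 : 0 < rho by rewrite mulr_gt0.
have rhor : rho <= r by rewrite /rho; nra.
(* Caps of chordal radius [rho / 2] have measure at least [M^-1] by [contract], as
   [v / 2 = (8 * D)^-1]; by [capf_packing] a separated set has at most [M] points. *)
pose M := (8 * D) ^+ 2 ^+ d.+1 / p.
have M0 : 0 < M by rewrite divr_gt0 // !exprn_gt0 //; lra.
have bnd (Y : seq 'rV[R]_d.+1) : {in Y, forall y, dotmul y y = 1} ->
    pairwise (fun x y => rho < enorm (x - y)) Y -> (size Y)%:R <= M.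
  move=> Y1 Ysep; have h0 : 0 <= rho / 2 by lra.
  have e2 : 2 * (rho / 2) = rho by lra.
  have := capf_packing h0 Y1; rewrite e2 => /(_ Ysep) h.
  pose b := (v / 2) ^+ 2.
  have hb : 0 < b <= 1.
    by rewrite /b exprn_gt0 ?exprn_ile1 //; lra.
  have eb : 1 - (rho / 2) ^+ 2 / 2 = 1 - b * (1 - c).
    by rewrite /rho /b !exprMn r2 /u; field.
  rewrite eb in h; have hc := contract b hb.
  have : (size Y)%:R * (b ^+ d.+1 * p) <= 1.
    by apply: le_trans h; rewrite ler_wpM2l.
  rewrite mulrA -ler_pdivlMr // -ler_pdivlMr; last by rewrite exprn_gt0 //; case/andP: hb.
  move=> /le_trans; apply; rewrite le_eqVlt; apply/orP; left; apply/eqP.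
  rewrite /M mul1r mulrC; congr (_ * _); rewrite -exprVn; congr (_ ^+ _).
  rewrite /b -exprVn; congr (_ ^+ 2); rewrite invfM invrK.
  have vE : v^-1 = 4 * D.
    by apply: (mulfI (lt0r_neq0 v0)); rewrite mulfV ?gt_eqF // mulrCA (mulrC v) Dv; lra.
  by rewrite vE; ring.
have [Y [Y1 Ysep Ycov]] := @separated_net R d (fun y => dotmul y y = 1)
  (fun x y => rho < enorm (x - y)) (Num.truncn M) (fun Y h1 h2 =>
    ltac:(rewrite -ltnS -(ltr_nat R); exact: le_lt_trans (bnd Y h1 h2) (truncnS_gt _))).
pose y (i : 'I_(size Y)) := nth 0 Y i.
have y1 i : dotmul (y i) (y i) = 1 by apply: Y1; exact: mem_nth.
pose t := 1 - (r - rho) ^+ 2 / 2.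
(* Shrinking the radius by the factor [1 - v] costs at most a factor 2, because
   [2 * D * v = 1/2]. *)
have ft : p / 2 <= capf d t.
  pose b := (1 - v) ^+ 2.
  have hb : 0 < b <= 1 by rewrite /b exprn_gt0 ?exprn_ile1 //; lra.
  have -> : t = 1 - b * (1 - c).
    have -> : 1 - c = r ^+ 2 / 2 by rewrite r2 /u; lra.
    by rewrite /t /b /rho; ring.
  apply: le_trans (contract b hb); rewrite mulrC ler_pM2r //.
  have hv : -1 <= - v by lra.
  have := bernoulli (2 * d.+1) hv; rewrite /b -exprM; apply: le_trans.
  by rewrite natrM -DE mulrN -mulrA Dv; lra.
pose g z (i : 'I_(size Y)) : R := 1 - (t <= dotmul z (y i))%R%:R.
have g0 z i : 0 <= g z i by rewrite /g; case: (t <= _) => /=; lra.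
have th0 : 0 <= 1 - p / 2 by lra.
(* Large enough for [expR (- (p / 2)) ^+ N] to cancel the power of [8 * D] in [M], which leaves at
   most [p^-1] missed net points. *)
have [N NE] : exists N, N = (Num.truncn (4 * D * ln (8 * D) / p)).+1 by eexists.
have [|s0 [s0N s01 hs0]] := @greedy R d _ (index_enum 'I_(size Y)) g _ N g0 th0.
  move=> w w0.
  have [z z1 hz] := capf_average (index_enum 'I_(size Y)) (fun i => - w i) (fun=> t) y1.
  exists z => //; rewrite /g.
  have -> : \sum_i w i * (1 - (t <= dotmul z (y i))%R%:R) =
      \sum_i w i + \sum_i - w i * (t <= dotmul z (y i))%R%:R.
    by rewrite -big_split; apply: eq_bigr => i _ /=; ring.
  apply: (@le_trans _ _ (\sum_i w i + \sum_i - w i * capf d t)); first by rewrite lerD2l.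
  rewrite -mulr_suml sumrN.
  have : 0 <= \sum_i w i by apply: sumr_ge0.
  set W := \sum_i w i => W0; nra.
pose miss (i : 'I_(size Y)) := all (fun z => ~~ (t <= dotmul z (y i))) s0.
pose U := [seq y i | i <- index_enum 'I_(size Y) & miss i].
have sU : (size U)%:R <= p^-1.
  have -> : (size U)%:R = \sum_i \prod_(z <- s0) g z i.
    rewrite size_map size_filter -sum1_count natr_sum [LHS]big_mkcond /=.
    apply: eq_bigr => i _; rewrite /miss.
    elim: (s0) => [|z s IH]; first by rewrite big_nil.
    rewrite big_cons /= -IH /g.
    by case: (t <= _) => /=; rewrite ?subrr ?mul0r // subr0 mul1r.
  apply: le_trans hs0 _.
  have sY : (size (index_enum 'I_(size Y)))%:R <= M.
    have -> : size (index_enum 'I_(size Y)) = size Y.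
      by rewrite -sum1_size -[RHS]card_ord -sum1_card.
    exact: bnd.
  apply: (@le_trans _ _ ((1 - p / 2) ^+ N * M)); first by rewrite ler_wpM2l ?exprn_ge0.
  rewrite /M mulrA -[leRHS]mul1r ler_pM2r ?invr_gt0 //.
  apply: (@le_trans _ _ (expR (- (p / 2)) ^+ N * (8 * D) ^+ 2 ^+ d.+1)).
    rewrite ler_pM2r ?exprn_gt0 //; last by lra.
    by apply: lerXn2r; rewrite ?nnegrE ?expR_ge0 //; have := expR_ge1Dx (- (p / 2)).
  rewrite -[X in _ * X]lnK; last by rewrite posrE !exprn_gt0 //; lra.
  rewrite -expRM_natl -expRD -[leRHS]expR0 ler_expR -exprM lnXn; last by lra.
  rewrite -[_ *+ (2 * d.+1)]mulr_natl natrM -DE.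
  have : 4 * D * ln (8 * D) / p < N%:R by rewrite NE truncnS_gt.
  rewrite ltr_pdivrMr //; set L := ln (8 * D); set n := N%:R; nra.
exists (s0 ++ U); last first.
  have h : 0 <= 4 * D * ln (8 * D) / p.
    by apply: divr_ge0 (ltW p0); apply: mulr_ge0 => //; exact: ln_ge0.
  rewrite size_cat natrD s0N mulrDl mul1r addrAC lerD // NE -natr1 lerD2r.
  by rewrite truncn_le.
split.
  move=> z; rewrite mem_cat => /orP[/s01 //|/mapP[i _ ->]]; exact: y1.
move=> x x1; have [y' y'Y xy] := Ycov x x1.
have {}xy : enorm (x - y') <= rho by rewrite leNgt.
have [i iy] : exists i, y i = y'.
  have h : (index y' Y < size Y)%N by rewrite index_mem.
  by exists (Ordinal h); rewrite /y /= nth_index.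
have cE : c = 1 - r ^+ 2 / 2 by rewrite r2 /u; lra.
(* A missed net point belongs to [U] and covers [x] itself; otherwise some [z] is within [r - rho]
   of the net point, hence within [r] of [x]. *)
have [im|] := boolP (miss i).
  exists y'; first by rewrite mem_cat -iy map_f ?orbT // mem_filter im mem_index_enum.
  rewrite cE chord ?(ltW r0) //; last by rewrite -iy.
  rewrite enormB; exact: le_trans rhor.
case/allPn => z zs; rewrite negbK => tz; exists z; first by rewrite mem_cat zs.
have z1 := s01 z zs.
move: tz; rewrite /t cE !chord ?(ltW r0) ?subr_ge0 // iy => tz.
have := enormD (z - y') (y' - x); rewrite addrA subrK (enormB y'); lra.
Qed.

End small_caps.

(** * Randomized rounding *)

Section rounding.
Context (R : realType).

(** An upper bound for minus the logarithm of the gain at level [t], see [expR_psi_gain]. Being a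
    combination of two exponentials, it has a mean under independent rounding that splits into
    products over the coordinates. *)
Definition psi (t : R) : R := expR (14 * (t - 1)) - 256^-1 * expR (4 * (t - 1)).

(* The level of [<z, y>] relative to [c * |y|] in units of [h]; [|y|] is replaced
   by [(1 + |y| ^ 2) / 2], which differs from it by [(|y| - 1) ^ 2 / 2] only, so
   that [expR (tau c h z y)] is a product over the coordinates of [y]. *)
Definition tau n (c h : R) (z y : 'rV[R]_n) : R :=
  (dotmul z y - c * (1 + dotmul y y) / 2) / h.

Lemma expR1_ge2 : 2 <= expR (1 : R).
Proof. by have := expR_ge1Dx (1 : R); lra. Qed.

Lemma expR_nat_ge n : 2 ^+ n <= expR (n%:R : R).
Proof.
rewrite -[n%:R]mulr1 expRM_natl; apply: lerXn2r; rewrite ?nnegrE ?expR_ge0 //.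
exact: expR1_ge2.
Qed.

Lemma expR_le_inv (x : R) : x < 1 -> expR x <= (1 - x)^-1.
Proof.
move=> x1; rewrite -[x in expR x]opprK expRN lef_pV2 ?posrE ?expR_gt0 //; last lra.
exact: expR_ge1Dx.
Qed.

Lemma expR_le_quad (x : R) : `|x| <= 2^-1 -> expR x <= 1 + x + 2 * x ^+ 2.
Proof.
rewrite ler_norml => /andP[x1 x2].
apply: le_trans (expR_le_inv _) _; first by lra.
rewrite -[leLHS]mul1r ler_pdivrMr; last by lra.
have : 0 <= x ^+ 2 * (1 - 2 * x) by rewrite mulr_ge0 ?sqr_ge0 //; lra.
have -> : (1 + x + 2 * x ^+ 2) * (1 - x) = 1 + x ^+ 2 * (1 - 2 * x) by ring.
lra.
Qed.

(** Jensen, by the tangent line of the exponential at the mean. *)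
Lemma two_point_ge (f u0 u1 : R) : 0 <= f <= 1 ->
  expR ((1 - f) * u0 + f * u1) <= (1 - f) * expR u0 + f * expR u1.
Proof.
move=> /andP[f0 f1]; set m := _ + f * u1.
have h u : expR m * (1 + (u - m)) <= expR u.
  have -> : expR u = expR m * expR (u - m) by rewrite -expRD addrC subrK.
  by rewrite ler_wpM2l ?expR_ge0 // expR_ge1Dx.
have h0 := h u0; have h1 := h u1.
have : (1 - f) * (expR m * (1 + (u0 - m))) + f * (expR m * (1 + (u1 - m))) = expR m.
  by rewrite /m; ring.
have : (1 - f) * (expR m * (1 + (u0 - m))) <= (1 - f) * expR u0 by rewrite ler_wpM2l //; lra.
have : f * (expR m * (1 + (u1 - m))) <= f * expR u1 by rewrite ler_wpM2l.
lra.
Qed.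

(** A centred Bernoulli variable is subgaussian: the linear terms of the quadratic bound on the
    exponential cancel. *)
Lemma two_point_le (f a : R) : 0 <= f <= 1 -> `|a| <= 2^-1 ->
  (1 - f) * expR (a * (0 - f)) + f * expR (a * (1 - f)) <= expR (2 * a ^+ 2).
Proof.
move=> /andP[f0 f1] a1.
have h b : `|b| <= 1 -> expR (a * b) <= 1 + a * b + 2 * a ^+ 2.
  move=> b1; have ab : `|a * b| <= 2^-1 by rewrite normrM; have := normr_ge0 b; nra.
  apply: le_trans (expR_le_quad ab) _; rewrite exprMn lerD2l ler_wpM2l //.
  by rewrite -[leRHS]mulr1 ler_wpM2l ?sqr_ge0 // -real_normK ?num_real // expr_le1.
have h0 := h (0 - f) _; have h1 := h (1 - f) _.
apply: le_trans (expR_ge1Dx _).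
have {}h0 : (1 - f) * expR (a * (0 - f)) <= (1 - f) * (1 + a * (0 - f) + 2 * a ^+ 2).
  by rewrite ler_wpM2l ?h0 ?ler_norml; lra.
have {}h1 : f * expR (a * (1 - f)) <= f * (1 + a * (1 - f) + 2 * a ^+ 2).
  by rewrite ler_wpM2l ?h1 ?ler_norml; lra.
lra.
Qed.

(** The probability of [e] when its entries are independent and [e i] is true with probability
    [f i]; the displacement in [roundv] then has mean zero. *)
Definition roundw n (f : 'I_n -> R) (e : {ffun 'I_n -> bool}) : R :=
  \prod_i (if e i then f i else 1 - f i).

Definition roundv n (x : 'rV[R]_n) (eta : R) (f : 'I_n -> R) (e : {ffun 'I_n -> bool}) :=
  x + \row_i (eta * ((e i)%:R - f i)).

Lemma roundw_prod n (f : 'I_n -> R) (F : 'I_n -> bool -> R) :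
  \sum_(e : {ffun 'I_n -> bool}) roundw f e * \prod_i F i (e i) =
  \prod_i ((1 - f i) * F i false + f i * F i true).
Proof.
transitivity (\prod_i \sum_(b : bool) (if b then f i else 1 - f i) * F i b).
  rewrite bigA_distr_bigA; apply: eq_bigr => e _.
  by rewrite /roundw -big_split.
by apply: eq_bigr => i _; rewrite big_bool /= [LHS]addrC.
Qed.

Lemma roundw_sum n (f : 'I_n -> R) : \sum_e roundw f e = 1.
Proof.
transitivity (\sum_e roundw f e * \prod_(i < n) (1 : R)).
  by apply: eq_bigr => e _; rewrite big1 ?mulr1.
by rewrite (roundw_prod f (fun _ _ => 1)) big1 // => i _; lra.
Qed.

Lemma roundw_ge0 n (f : 'I_n -> R) e : (forall i, 0 <= f i <= 1) -> 0 <= roundw f e.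
Proof.
by move=> f01; apply: prodr_ge0 => i _; have /andP[] := f01 i; case: (e i) => *; lra.
Qed.

Lemma tau_roundv n (c h eta : R) (z x : 'rV[R]_n) f e : h != 0 ->
  dotmul x x = 1 ->
  tau c h z (roundv x eta f e) = (dotmul z x - c) / h +
    \sum_i ((z 0 i - c * x 0 i) * eta * ((e i)%:R - f i)
            - c / 2 * eta ^+ 2 * ((e i)%:R - f i) ^+ 2) / h.
Proof.
move=> h0 x1; rewrite -mulr_suml -mulrDl /tau; congr (_ / _).
rewrite /roundv; set w := \row_i _; rewrite !(dotmulDl, dotmulDr) x1 (dotmulC w x).
rewrite [in RHS]sumrB.
have -> : \sum_i (z 0 i - c * x 0 i) * eta * ((e i)%:R - f i) = dotmul z w - c * dotmul x w.
  rewrite /dotmul mulr_sumr -sumrB; apply: eq_bigr => i _; rewrite mxE; ring.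
have -> : \sum_i c / 2 * eta ^+ 2 * ((e i)%:R - f i) ^+ 2 = c / 2 * dotmul w w.
  rewrite /dotmul mulr_sumr; apply: eq_bigr => i _; rewrite mxE; ring.
lra.
Qed.

(* The rounding error has mean zero, so the exponential of rate 4 loses little
   by Jensen, while the one of rate 14 gains at most a constant factor since the
   rounding error is subgaussian; the factor expR (-14) then makes the rate 14
   term the smaller one as long as [z] lies below the level [c]. *)
Lemma sum_psi_le0 n (c h : R) (z x : 'rV[R]_n) (f : 'I_n -> R) :
  dotmul x x = 1 -> dotmul z z = 1 -> (forall i, 0 <= f i <= 1) ->
  0 <= c <= 2^-1 -> 0 < h -> c * h * n%:R <= 32^-1 -> dotmul z x <= c ->
  \sum_e roundw f e * psi (tau c h z (roundv x (h / 56) f e)) <= 0.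
Proof.
move=> x1 z1 f01 /andP[c0 c1] h0 chn zx.
pose s := (dotmul z x - c) / h.
have s0 : s <= 0 by rewrite /s pmulr_lle0 ?invr_gt0 // subr_le0.
pose F A i (b : bool) := expR (A * (((z 0 i - c * x 0 i) * (h / 56) * (b%:R - f i)
            - c / 2 * (h / 56) ^+ 2 * (b%:R - f i) ^+ 2) / h)).
have E A : \sum_e roundw f e * expR (A * (tau c h z (roundv x (h / 56) f e) - 1)) =
    expR (A * (s - 1)) * \prod_i ((1 - f i) * F A i false + f i * F A i true).
  rewrite -roundw_prod mulr_sumr; apply: eq_bigr => e _.
  rewrite tau_roundv ?gt_eqF // -/s addrAC mulrDr expRD mulrCA; congr (_ * (_ * _)).
  by rewrite mulr_sumr expR_sum.
(* The linear coefficient is 14 / 56 = 1/4 and the quadratic term only helps, so the subgaussian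
   exponents add up to the squared norm of [z - c *: x] over 8, which is below 1. *)
have hu : \prod_i ((1 - f i) * F 14 i false + f i * F 14 i true) <= expR 1.
  apply: (@le_trans _ _ (\prod_i expR (2 * ((z 0 i - c * x 0 i) / 4) ^+ 2))).
    apply: ler_prod => i _.
    have /andP[f0 f1] := f01 i.
    apply/andP; split; first by rewrite addr_ge0 ?mulr_ge0 ?expR_ge0 //; lra.
    have ai : `|(z 0 i - c * x 0 i) / 4| <= 2^-1.
      have coord (v : 'rV[R]_n) : dotmul v v = 1 -> `|v 0 i| <= 1.
        move=> v1; rewrite -(expr_le1 (n := 2)) // real_normK ?num_real // -v1.
        rewrite /dotmul (bigD1 i) //= -expr2 lerDl.
        by apply: sumr_ge0 => j _; rewrite -expr2 sqr_ge0.
      have := coord z z1; have := coord x x1; rewrite !ler_norml => /andP[? ?] /andP[? ?].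
      by apply/andP; split; nra.
    apply: le_trans (two_point_le (f01 i) ai).
    have Fle b : F 14 i b <= expR ((z 0 i - c * x 0 i) / 4 * (b%:R - f i)).
      rewrite ler_expR.
      have -> : 14 * (((z 0 i - c * x 0 i) * (h / 56) * (b%:R - f i) -
          c / 2 * (h / 56) ^+ 2 * (b%:R - f i) ^+ 2) / h) =
          (z 0 i - c * x 0 i) / 4 * (b%:R - f i) - c * h * (b%:R - f i) ^+ 2 / 448.
        by field; rewrite gt_eqF.
      rewrite gerDl oppr_le0; apply: divr_ge0 (ler0n _ _).
      by apply: mulr_ge0 (sqr_ge0 _); exact: mulr_ge0 c0 (ltW h0).
    apply: lerD; first by apply: ler_wpM2l (Fle false); lra.
    exact: ler_wpM2l (Fle true).
  rewrite -expR_sum ler_expR -mulr_sumr.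
  have -> : \sum_i ((z 0 i - c * x 0 i) / 4) ^+ 2 = dotmul (z - c *: x) (z - c *: x) / 16.
    by rewrite /dotmul mulr_suml; apply: eq_bigr => i _; rewrite !mxE; field.
  rewrite !(dotmulBl, dotmulBr, dotmulZl, dotmulZr) x1 z1 (dotmulC x z).
  have /andP[] : -1 <= dotmul z x <= 1.
    have := dotmul_le z x; have := dotmul_le (- z) x.
    rewrite dotmulNl enormN /enorm x1 z1 !sqrtr1 mulr1 => ? ?; apply/andP; split; lra.
  move=> *; nra.
(* The linear terms have mean zero, and the quadratic ones cost at most [c * h * n / 1568] in the
   exponent. *)
have hl : expR (-1) <= \prod_i ((1 - f i) * F 4 i false + f i * F 4 i true).
  apply: (@le_trans _ _ (\prod_(i < n) expR (- (c * h / 1568)))).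
    rewrite -expR_sum ler_expR sumr_const card_ord -[_ *+ n]mulr_natl; lra.
  apply: ler_prod => i _; rewrite expR_ge0 /=; apply: le_trans (two_point_ge _ _ (f01 i)).
  rewrite ler_expR /=.
  have -> : (1 - f i) * (4 * (((z 0 i - c * x 0 i) * (h / 56) * (false%:R - f i) -
        c / 2 * (h / 56) ^+ 2 * (false%:R - f i) ^+ 2) / h)) +
      f i * (4 * (((z 0 i - c * x 0 i) * (h / 56) * (true%:R - f i) -
        c / 2 * (h / 56) ^+ 2 * (true%:R - f i) ^+ 2) / h)) =
      - (c * h / 1568) * (f i * (1 - f i)).
    by rewrite /= ?mulr0n ?mulr1n; field; rewrite gt_eqF.
  have /andP[f0 f1] := f01 i.
  have : 0 <= c * h by rewrite mulr_ge0 // ltW.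
  move=> ?; have : f i * (1 - f i) <= 1 by nra.
  nra.
rewrite /psi; under eq_bigr => e _ do rewrite mulrBr mulrCA.
rewrite sumrB -mulr_sumr !E subr_le0.
(* As [s <= 0], the exponent [14 * (s - 1) + 1] is at most [-8 + 4 * (s - 1) - 1], and
   [expR (-8) <= 256^-1]. *)
apply: (@le_trans _ _ (expR (14 * (s - 1)) * expR 1)); first by rewrite ler_wpM2l ?expR_ge0.
apply: (@le_trans _ _ (256^-1 * (expR (4 * (s - 1)) * expR (-1)))); last first.
  by rewrite ler_wpM2l // ler_wpM2l ?expR_ge0.
rewrite -!expRD.
apply: (@le_trans _ _ (expR (-8) * expR (4 * (s - 1) - 1))).
  by rewrite -expRD ler_expR; lra.
rewrite ler_pM2r ?expR_gt0 // expRN lef_pV2 ?posrE ?expR_gt0 //.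
by apply: le_trans (expR_nat_ge 8); rewrite -natrX ler_nat.
Qed.

End rounding.

(** * Scalar estimates *)

Section scalar.
Context (R : realType).

(* Reaching level 1, i.e. [l = 0], costs 1/4; the excess over 1 collected at the
   lower levels [1 - l] decays geometrically, faster than the measure of the caps
   at these levels grows, yet it dominates [- psi] there. *)
Definition weight (l : nat) : R :=
  if l is j.+1 then 128^-1 * expR (-4) ^+ j else - 4^-1.

Definition hit (l : nat) (t : R) : R := (1 - l%:R <= t)%R%:R.

Lemma expRN4_le : expR (-4 : R) <= 16^-1.
Proof.
rewrite expRN lef_pV2 ?posrE ?expR_gt0 //.
by apply: le_trans (@expR_nat_ge R 4); rewrite -natrX ler_nat.
Qed.

Lemma weight_ge0 j : 0 <= weight j.+1.
Proof. by rewrite mulr_ge0 ?invr_ge0 // exprn_ge0 // expR_ge0. Qed.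

Lemma one_plus_weights_ge J (b : 'I_J.+1 -> bool) :
  3 / 4 <= 1 + \sum_(l < J.+1) weight l * (b l)%:R.
Proof.
rewrite big_ord_recl /=.
have : 0 <= \sum_(i < J) weight (lift ord0 i) * (b (lift ord0 i))%:R.
  by apply: sumr_ge0 => i _; rewrite mulr_ge0 // weight_ge0.
by case: (b ord0) => /=; lra.
Qed.

(** From level 1 on, [psi] is at least 1/2, and [expR (- 2^-1) <= 3/4]. Below, the weight of the
    first level reached, [1 - j.+1], suffices alone, since [4 * (t - 1) < -4 * j]. *)
Lemma expR_psi_le J (t : R) : 1 - J%:R <= t ->
  expR (- psi t) <= 1 + \sum_(l < J.+1) weight l * hit l t.
Proof.
move=> Jt; have [t1|t1] := leP 1 t.
  apply: le_trans (one_plus_weights_ge _).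
  apply: (@le_trans _ _ (expR (- 2^-1))).
    rewrite ler_expR lerN2 /psi.
    have h : expR (4 * (t - 1)) <= expR (14 * (t - 1)) by rewrite ler_expR; lra.
    have h1 : 1 <= expR (14 * (t - 1)) by rewrite -[leLHS]expR0 ler_expR; lra.
    lra.
  rewrite expRN invf_ple ?posrE ?expR_gt0 //.
  have := expR_ge1Dx (2^-1 : R); lra.
have ex : exists l, 1 - l%:R <= t by exists J.
have := ex_minnP ex; case=> -[|j] hj jmin; first by rewrite subr0 leNgt t1 in hj.
have jt : t < 1 - j%:R.
  by rewrite ltNge; apply/negP => /jmin; rewrite ltnn.
have jJ : (j < J)%N by rewrite -ltnS; exact: jmin.
have hit0 : hit (ord0 : 'I_J.+1) t = 0 by rewrite /hit mulr0n subr0 leNgt t1.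
rewrite big_ord_recl hit0 mulr0 add0r.
have hitj : hit (lift ord0 (Ordinal jJ)) t = 1 by rewrite /hit /= /bump /= add1n hj.
rewrite (bigD1 (Ordinal jJ)) //= hitj mulr1 addrA.
apply: ler_wpDr.
  by apply: sumr_ge0 => i _; rewrite mulr_ge0 // mulr_ge0 ?invr_ge0 // exprn_ge0 // expR_ge0.
have vj : expR (4 * (t - 1)) <= expR (-4) ^+ j.
  rewrite -expRM_natl ler_expR; lra.
set v := expR (4 * (t - 1)) in vj.
have v0 : 0 <= v by exact: expR_ge0.
have v1 : v <= 1 by rewrite -[leRHS]expR0 ler_expR; lra.
apply: (@le_trans _ _ (expR (256^-1 * v))).
  rewrite ler_expR /psi -/v; have := expR_ge0 (14 * (t - 1)); lra.
apply: le_trans (expR_le_inv _) _; first by lra.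
rewrite -[leLHS]mul1r ler_pdivrMr; last by lra.
nra.
Qed.

Lemma geometric_le (q : R) n : 0 <= q < 1 -> \sum_(0 <= j < n) q ^+ j <= (1 - q)^-1.
Proof.
move=> /andP[q0 q1].
have -> : \sum_(0 <= j < n) q ^+ j = (1 - q ^+ n) / (1 - q).
  elim: n => [|n IH]; first by rewrite big_geq // expr0 subrr mul0r.
  by rewrite big_nat_recr //= IH exprS; field; lra.
by rewrite ler_piMl ?invr_ge0 ?gerBl ?exprn_ge0 //; lra.
Qed.

(** Level 0 contributes at most [- p / 16]. The others form a series of ratio [8 * expR (-4) <= 1/2]
    and total at most [p / 64]. *)
Lemma sum_weights_le J (p : R) (f : nat -> R) : 0 <= p -> p / 4 <= f 0%N ->
  (forall j, f j.+1 <= 8 ^+ j * p) ->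
  \sum_(l < J.+1) weight l * f l <= - (p / 32).
Proof.
move=> p0 f0 fj; rewrite big_ord_recl /=.
have : \sum_(i < J) weight (lift ord0 i) * f (lift ord0 i) <= p / 64.
  apply: (@le_trans _ _ (\sum_(0 <= j < J) 2^-1 ^+ j * (p / 128))).
    rewrite big_mkord; apply: ler_sum => i _; rewrite /= /bump /= add1n.
    apply: (@le_trans _ _ (128^-1 * expR (-4) ^+ i * (8 ^+ i * p))).
      by rewrite ler_wpM2l // mulr_ge0 ?invr_ge0 // exprn_ge0 // expR_ge0.
    have -> : 128^-1 * expR (-4) ^+ i * (8 ^+ i * p) = (expR (-4) * 8) ^+ i * (p / 128).
      by rewrite exprMn; field.
    rewrite ler_wpM2r; [by []|lra|].
    apply: lerXn2r; rewrite ?nnegrE ?mulr_ge0 ?expR_ge0 ?invr_ge0 //.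
    have := expRN4_le; lra.
  rewrite -mulr_suml.
  have h : 0 <= (2^-1 : R) < 1 by apply/andP; split; lra.
  have := geometric_le J h; have -> : (1 - 2^-1 : R)^-1 = 2 by field.
  nra.
lra.
Qed.

Lemma two_sided_geometric (s : R) m M : 0 < s ->
  \sum_(0 <= j < m) expR (- s * `|j%:R - M%:R|) <= 2 / (1 - expR (- s)).
Proof.
move=> s0; pose q := expR (- s).
have hq : 0 <= q < 1 by rewrite /q expR_ge0 /= -[ltRHS]expR0 ltr_expR; lra.
have w0 j : 0 <= expR (- s * `|j%:R - M%:R|) by exact: expR_ge0.
apply: (@le_trans _ _ (\sum_(0 <= j < M + m) expR (- s * `|j%:R - M%:R|))).
  rewrite [leRHS](big_cat_nat _ (n := m)) ?leq_addl //= lerDl.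
  by apply: sumr_ge0 => j _.
rewrite (big_cat_nat _ (n := M)) ?leq_addr //=.
have -> : 2 / (1 - expR (- s)) = (1 - q)^-1 + (1 - q)^-1 by rewrite /q; ring.
apply: lerD.
  apply: le_trans (geometric_le M hq); rewrite big_nat_rev /= add0n.
  rewrite !big_nat; apply: ler_sum => j /andP[_ jM].
  rewrite /q -expRM_natl ler_expR distrC.
  have -> : M%:R - (M - j.+1)%:R = j.+1%:R :> R by rewrite natrB // subKr.
  by rewrite ger0_norm // -natr1; lra.
apply: le_trans (geometric_le m hq).
rewrite -{1}[M]add0n big_addn addnC addnK !big_nat; apply: ler_sum => j _.
by rewrite /q -expRM_natl ler_expR natrD addrK ger0_norm // mulrC.
Qed.

Definition lattice n m M (eta : R) (k : {ffun 'I_n -> 'I_m}) : 'rV[R]_n :=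
  \row_i (eta * ((k i)%:R - M%:R)).

(** Exponential weights: on the ball of radius 2, [rho * a <= (rho ^+ 2 * a ^+ 2 + 1) / 2] makes
    [expR 3 ^+ n * \prod_i w (k i)] at least 1, and the sum over all [k] factors into geometric
    series. The bound does not depend on the size [m] of the box. *)
Lemma lattice_count n m M (eta rho : R) : 0 < rho <= 1 -> rho ^+ 2 = eta ^+ 2 * n%:R ->
  \sum_(k : {ffun 'I_n -> 'I_m} | dotmul (lattice M eta k) (lattice M eta k) <= 4) 1 <=
  (expR 3 * (4 / rho)) ^+ n.
Proof.
move=> /andP[r0 r1] re.
pose w (j : nat) := expR (- rho * `|j%:R - M%:R|).
apply: (@le_trans _ _ (\sum_(k : {ffun 'I_n -> 'I_m}) expR 3 ^+ n * \prod_i w (k i))).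
  rewrite big_mkcond; apply: ler_sum => k _; case: ifP => [kk|_]; last first.
    by rewrite mulr_ge0 ?exprn_ge0 ?expR_ge0 // prodr_ge0 // => i _; exact: expR_ge0.
  rewrite /w -expR_sum -expRM_natl -expRD -[leLHS]expR0 ler_expR -mulr_sumr.
  have h : rho * \sum_i `|(k i)%:R - M%:R| <=
      \sum_(i < n) (n%:R * (lattice M eta k 0 i * lattice M eta k 0 i) / 2 + 2^-1).
    rewrite mulr_sumr; apply: ler_sum => i _; rewrite mxE.
    set a := (k i)%:R - M%:R.
    have -> : n%:R * (eta * a * (eta * a)) = (eta ^+ 2 * n%:R) * a ^+ 2 by ring.
    rewrite -re -[a ^+ 2]real_normK ?num_real //.
    have := sqr_ge0 (rho * `|a| - 1); nra.
  move: h; rewrite big_split /= sumr_const card_ord -mulr_suml -mulr_sumr.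
  rewrite -/(dotmul (lattice M eta k) (lattice M eta k)) -[2^-1 *+ n]mulr_natl.
  have : 0 <= n%:R :> R by [].
  nra.
rewrite -mulr_sumr exprMn ler_wpM2l ?exprn_ge0 ?expR_ge0 //.
have -> : \sum_(k : {ffun 'I_n -> 'I_m}) \prod_i w (k i) = (\sum_(j < m) w j) ^+ n.
  transitivity (\prod_(i < n) \sum_(j < m) w j); last by rewrite prodr_const card_ord.
  by rewrite bigA_distr_bigA.
apply: lerXn2r; rewrite ?nnegrE.
- by apply: sumr_ge0 => j _; exact: expR_ge0.
- by rewrite divr_ge0 // ltW.
have := two_sided_geometric m M r0; rewrite big_mkord; move=> /le_trans; apply.
rewrite ler_pdivrMr; last by rewrite subr_gt0 -[ltRHS]expR0 ltr_expR; lra.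
have h : expR (- rho) <= (1 + rho)^-1.
  by rewrite expRN lef_pV2 ?posrE ?expR_gt0 ?expR_ge1Dx //; lra.
have h2 : (1 + rho)^-1 <= 1 - rho / 2.
  rewrite -[leLHS]mul1r ler_pdivrMr; [nra|lra].
rewrite mulrAC ler_pdivlMr //; nra.
Qed.

End scalar.

(** * Variation of the measure of a cap with its level *)

Section growth.
Context (R : realType) (d : nat).

Lemma capf_growth (c h : R) : 0 <= c <= 2^-1 -> 0 < h <= 32^-1 ->
  c * h * d.+1%:R <= 32^-1 -> h ^+ 2 * d.+1%:R <= 1024^-1 ->
  capf d c <= 4 * capf d (c + 2 * h) /\
  forall j, capf d (c - 2 * h * j%:R) <= 8 ^+ j * capf d c.
Proof.
move=> /andP[c0 c1] /andP[h0 h1] chD hhD.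
have D0 : 0 <= d.+1%:R :> R by [].
have step t : 0 <= t <= c -> capf d t <= 4 * capf d (t + 2 * h).
  move=> /andP[t0 tc].
  have k0 : 0 <= 2 * h by lra.
  have tk : t + 2 * h <= 3 / 4 by lra.
  apply: le_trans (capf_step d t0 k0 tk) _; rewrite ler_wpM2r ?capf_ge0 //.
  suff : Num.sqrt (1 + 8 * (2 * h) * (t + 2 * h) + 16 * (2 * h) ^+ 2) ^+ d.+1 <= 2 by lra.
  pose y := 16 * h * c + 96 * h ^+ 2.
  have ry : Num.sqrt (1 + 8 * (2 * h) * (t + 2 * h) + 16 * (2 * h) ^+ 2) <= expR (y / 2).
    rewrite -(ler_pXn2r (ltn0Sn 1)) ?nnegrE ?sqrtr_ge0 ?expR_ge0 //.
    rewrite sqr_sqrtr; last by nra.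
    rewrite -expRM_natl (_ : 2%:R * (y / 2) = y); last by field.
    apply: le_trans (expR_ge1Dx _).
    rewrite /y; nra.
  apply: (@le_trans _ _ (expR (y / 2) ^+ d.+1)).
    by apply: lerXn2r; rewrite ?nnegrE ?sqrtr_ge0 ?expR_ge0.
  rewrite -expRM_natl.
  apply: (@le_trans _ _ (expR 2^-1)).
    rewrite ler_expR /y.
    have -> : d.+1%:R * ((16 * h * c + 96 * h ^+ 2) / 2) =
      8 * (c * h * d.+1%:R) + 48 * (h ^+ 2 * d.+1%:R) by field.
    lra.
  apply: le_trans (expR_le_inv _) _; first by lra.
  by have -> : (1 - 2^-1 : R)^-1 = 2 by [field]; exact: lexx.
split; first by apply: step; rewrite c0 lexx.
have p0 (t : R) := capf_ge0 d t.
elim=> [|j IH]; first by rewrite mulr0 subr0 expr0 mul1r.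
have [H|H] := leP 0 (c - 2 * h * j.+1%:R).
  have := step (c - 2 * h * j.+1%:R) _; rewrite H /= => /(_ _) hs.
  have {}hs := hs _.
  apply: le_trans (hs _) _; first by rewrite gerBl mulr_ge0 //; lra.
  rewrite (_ : c - 2 * h * j.+1%:R + 2 * h = c - 2 * h * j%:R); last by rewrite -natr1; ring.
  apply: (@le_trans _ _ (4 * (8 ^+ j * capf d c))); first by rewrite ler_wpM2l.
  by rewrite exprS -[leRHS]mulrA ler_wpM2r ?ler_nat // mulr_ge0 ?exprn_ge0.
(* Below the equator [capf_step] is replaced by [capf <= 1 <= 2 * capf d 0]; this extra factor 2 is
   why the ratio is 8 and not 4. *)
have f0 : capf d 0 <= 8 ^+ j.+1 / 2 * capf d c; last first.
  have := capf0_ge R d; have := capf_le1 d (c - 2 * h * j.+1%:R); lra.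
apply: (@le_trans _ _ (4 * capf d (c - 2 * h * j%:R))); last first.
  rewrite (_ : 8 ^+ j.+1 / 2 * capf d c = 4 * (8 ^+ j * capf d c)).
    by rewrite ler_wpM2l.
  by rewrite exprS; field.
have [H2|H2] := leP 0 (c - 2 * h * j%:R); last first.
  have := capf_antitone d (ltW H2); have := p0 0; lra.
apply: le_trans (step 0 _) _; first by rewrite lexx c0.
rewrite add0r ler_wpM2l //; apply: capf_antitone.
move: H; rewrite -natr1; lra.
Qed.

End growth.

(** * Covering by large caps *)

Section large_caps.
Context (R : realType) (d : nat).
Implicit Types (x y z : 'rV[R]_d.+1) (c h r : R).

(** The condition [1 - l <= tau c h z y] solved for the inner product of [z] with the direction of
    [y], where [r = enorm y]. *)
Definition thr c h r (l : nat) : R := (c * (1 + r ^+ 2) / 2 + (1 - l%:R) * h) / r.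

(** The value [pole] at 0 makes this a unit vector for every [y], as [capf_average] requires. *)
Definition unitize y := if y == 0 then pole R d else (enorm y)^-1 *: y.

Definition gain c h J z y : R :=
  1 + \sum_(l < J.+1) weight R l * (thr c h (enorm y) l <= dotmul z (unitize y))%R%:R.

(** The tolerance is the diagonal of a lattice cell of side [h / 56]. *)
Definition near_sphere h y : bool :=
  (`|enorm y - 1| <= h / 56 * Num.sqrt d.+1%:R).

Lemma dotmul_unitize y : dotmul (unitize y) (unitize y) = 1.
Proof.
rewrite /unitize; case: eqVneq => [_|y0]; first exact: dotmul_pole.
by rewrite dotmulZl dotmulZr -sqr_enorm; field; rewrite enorm_eq0.
Qed.

Lemma thr_le_unitize c h l z y : y != 0 -> 0 < h ->
  (thr c h (enorm y) l <= dotmul z (unitize y)) = (1 - l%:R <= tau c h z y).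
Proof.
move=> y0 h0; have r0 : 0 < enorm y by rewrite enorm_gt0.
rewrite /thr /unitize (negbTE y0) dotmulZr ler_pdivrMr //.
rewrite [leRHS]mulrC [leRHS]mulrA mulfV ?gt_eqF // mul1r.
by rewrite /tau ler_pdivlMr // sqr_enorm lerBrDl.
Qed.

Lemma near_sphere_bounds h y : 0 < h -> h ^+ 2 * d.+1%:R <= 1024^-1 ->
  near_sphere h y ->
  [/\ 3 / 4 <= enorm y, enorm y <= 5 / 4 & (enorm y - 1) ^+ 2 <= h ^+ 2 * d.+1%:R / 3136].
Proof.
move=> h0 hD; rewrite /near_sphere; set a := enorm y - 1 => na.
have na2 : a ^+ 2 <= h ^+ 2 * d.+1%:R / 3136.
  have -> : h ^+ 2 * d.+1%:R / 3136 = (h / 56 * Num.sqrt d.+1%:R) ^+ 2.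
    by rewrite exprMn sqr_sqrtr // exprMn exprVn; field.
  rewrite -[a ^+ 2]real_normK ?num_real //; apply: lerXn2r => //; rewrite nnegrE.
  by rewrite mulr_ge0 ?sqrtr_ge0 // divr_ge0 // ltW.
have a2 : a ^+ 2 <= 16^-1 by lra.
have : `|a| <= 4^-1.
  rewrite -(ler_pXn2r (ltn0Sn 1)) ?nnegrE // real_normK ?num_real //.
  by apply: le_trans a2 _; rewrite exprVn -natrX.
rewrite ler_norml /a => /andP[? ?]; split => //; lra.
Qed.

(** Here [thr c h r 0 - c = (c * (r - 1) ^+ 2 / 2 + h) / r], whose first term is tiny compared with
    [h]. *)
Lemma thr_top_le c h r : 0 <= c -> 0 < h -> c * h * d.+1%:R <= 32^-1 ->
  3 / 4 <= r -> (r - 1) ^+ 2 <= h ^+ 2 * d.+1%:R / 3136 ->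
  thr c h r 0 <= c + 2 * h.
Proof.
move=> c0 h0 chD r34 rq; have r0 : 0 < r by lra.
rewrite /thr mulr0n subr0 mul1r ler_pdivrMr //.
have hc : c * (r - 1) ^+ 2 <= h / 3136.
  apply: (@le_trans _ _ (c * (h ^+ 2 * d.+1%:R / 3136))); first by rewrite ler_wpM2l.
  have hh : 0 <= h * (32^-1 - c * h * d.+1%:R) by rewrite mulr_ge0 ?(ltW h0) // subr_ge0.
  lra.
have hr : 0 <= h * (r - 3 / 4) by rewrite mulr_ge0 // ?(ltW h0) //; lra.
lra.
Qed.

Lemma thr_level_ge c h r j : 0 <= c -> 0 < h -> 3 / 4 <= r ->
  c - 2 * h * j%:R <= thr c h r j.+1.
Proof.
move=> c0 h0 r34; have r0 : 0 < r by lra.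
rewrite /thr ler_pdivlMr // -(natr1 j).
have h2 : 0 <= c * (r - 1) ^+ 2 by rewrite mulr_ge0 ?sqr_ge0.
have h3 : 0 <= h * j%:R * (r - 2^-1) by rewrite !mulr_ge0 // ?(ltW h0) //; lra.
lra.
Qed.

(** [capf_average] is applied to the pairs of a point and a level. For each point, [capf_growth]
    bounds the measures at all levels and [sum_weights_le] adds them up. *)
Lemma gain_average (I : eqType) (Y : seq I) (y : I -> 'rV[R]_d.+1) c h J :
  0 <= c <= 2^-1 -> 0 < h <= 32^-1 ->
  c * h * d.+1%:R <= 32^-1 -> h ^+ 2 * d.+1%:R <= 1024^-1 ->
  {in Y, forall k, near_sphere h (y k)} ->
  forall w : I -> R, (forall k, 0 <= w k) ->
  exists2 z, dotmul z z = 1 & \sum_(k <- Y) w k * gain c h J z (y k) <=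
    (1 - capf d c / 32) * \sum_(k <- Y) w k.
Proof.
move=> c01 h01 chD hhD nearY w w0.
have [g0 gj] := capf_growth c01 h01 chD hhD.
have /andP[c0 _] := c01; have /andP[h0 _] := h01.
pose S := [seq (k, l) | k <- Y, l <- index_enum 'I_J.+1].
have [z z1 hz] := capf_average S (fun i => w i.1 * weight R i.2)
  (fun i => thr c h (enorm (y i.1)) i.2) (fun i => dotmul_unitize (y i.1)).
exists z => //.
have -> : \sum_(k <- Y) w k * gain c h J z (y k) = \sum_(k <- Y) w k +
   \sum_(i <- S) w i.1 * weight R i.2 * (thr c h (enorm (y i.1)) i.2 <=
      dotmul z (unitize (y i.1)))%R%:R.
  rewrite big_allpairs -big_split; apply: eq_bigr => k _ /=.
  rewrite /gain mulrDr mulr1 mulr_sumr; congr (_ + _).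
  by apply: eq_bigr => l _; rewrite mulrA.
apply: le_trans (lerD (lexx _) hz) _.
rewrite mulrBl mul1r lerD2l big_allpairs /= mulrC mulr_suml -sumrN.
rewrite big_seq [leRHS]big_seq; apply: ler_sum => k kY.
under eq_bigr => l _ do rewrite -mulrA.
rewrite -mulr_sumr -mulrN ler_wpM2l //.
have [r34 r54 rq] := near_sphere_bounds h0 hhD (nearY k kY).
apply: (@sum_weights_le R J _ (fun l => capf d (thr c h (enorm (y k)) l))).
- exact: capf_ge0.
- rewrite ler_pdivrMr // mulrC; apply: le_trans g0 _.
  by rewrite ler_wpM2l //; apply: capf_antitone; exact: thr_top_le.
- by move=> j; apply: le_trans (gj j); apply: capf_antitone; exact: thr_level_ge.
Qed.

Lemma gain_ge c h J z y : 3 / 4 <= gain c h J z y.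
Proof. exact: one_plus_weights_ge. Qed.

Lemma gain_ge0 c h J z y : 0 <= gain c h J z y.
Proof. by apply: le_trans (gain_ge _ _ _ _ _). Qed.

Lemma expR_psi_gain c h J z y : 0 <= c <= 2^-1 -> 0 < h ->
  h ^+ 2 * d.+1%:R <= 1024^-1 -> 1 + 3 / h <= J%:R ->
  near_sphere h y -> dotmul z z = 1 -> expR (- psi (tau c h z y)) <= gain c h J z y.
Proof.
move=> /andP[c0 c1] h0 hhD hJ yn z1.
have [r34 r54 _] := near_sphere_bounds h0 hhD yn.
have y0 : y != 0 by rewrite -enorm_gt0; lra.
have -> : gain c h J z y = 1 + \sum_(l < J.+1) weight R l * hit l (tau c h z y).
  by congr (_ + _); apply: eq_bigr => l _; rewrite thr_le_unitize.
apply: expR_psi_le.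
(* This lower bound on [tau] ensures that some level up to [J] is reached. *)
have : - (3 / h) <= tau c h z y.
  rewrite /tau -mulNr ler_pM2r ?invr_gt0 // -sqr_enorm.
  have := dotmul_le (- z) y; rewrite dotmulNl enormN (enorm1 z1) mul1r.
  have : enorm y ^+ 2 <= 2 by nra.
  have : 0 <= enorm y ^+ 2 by exact: sqr_ge0.
  nra.
lra.
Qed.

Lemma near_sphere_lattice c h x y : dotmul x x = 1 -> 0 < h ->
  (forall i, `|y 0 i - x 0 i| <= h / 56) -> near_sphere h y.
Proof.
move=> x1 h0 hxy; rewrite /near_sphere.
have nd : enorm (y - x) <= h / 56 * Num.sqrt d.+1%:R.
  have e0 : 0 <= h / 56 by rewrite divr_ge0 // ltW.
  rewrite -(ler_pXn2r (ltn0Sn 1)) ?nnegrE ?enorm_ge0 ?(mulr_ge0 e0 (sqrtr_ge0 _)) //.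
  rewrite sqr_enorm exprMn sqr_sqrtr //.
  apply: (@le_trans _ _ (\sum_(i < d.+1) (h / 56) ^+ 2)).
    apply: ler_sum => i _; rewrite !mxE -expr2 -real_normK ?num_real //.
    by apply: lerXn2r; rewrite ?nnegrE.
  by rewrite sumr_const card_ord -[leLHS]mulr_natr.
have e1 := enorm1 x1; rewrite ler_norml; apply/andP; split.
  by have := enormD (x - y) y; rewrite subrK enormB e1; lra.
by have := enormD (y - x) x; rewrite subrK e1; lra.
Qed.

(* If the points of [s] miss the cap around [x], then the gains, averaged over a
   randomized rounding of [x] to the lattice, are at least 1 since
   [expR u >= 1 + u]. *)
Lemma uncovered_gain c h J M (s : seq 'rV[R]_d.+1) x :
  0 <= c <= 2^-1 -> 0 < h <= 32^-1 ->
  c * h * d.+1%:R <= 32^-1 -> h ^+ 2 * d.+1%:R <= 1024^-1 -> 1 + 3 / h <= J%:R ->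
  56 / h <= M%:R ->
  {in s, forall z, dotmul z z = 1} -> dotmul x x = 1 ->
  {in s, forall z, dotmul z x < c} ->
  1 <= \sum_(k : {ffun 'I_d.+1 -> 'I_(2 * M).+2} | near_sphere h (lattice M (h / 56) k))
    \prod_(z <- s) gain c h J z (lattice M (h / 56) k).
Proof.
move=> c01 /andP[h0 h1] chD hhD hJ hM s1 x1 sx.
pose eta := h / 56; have eta0 : 0 < eta by rewrite divr_gt0.
have coord i : `|x 0 i| <= 1.
  rewrite -(expr_le1 (n := 2)) // real_normK ?num_real // -x1.
  rewrite /dotmul (bigD1 i) //= -expr2 lerDl.
  by apply: sumr_ge0 => j _; rewrite -expr2 sqr_ge0.
(* Coordinates of [x] in lattice units; the shift by [M >= 56 / h] puts them between 0 and [2 * M].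
   Rounding up may give [2 * M + 1], hence the index type ['I_(2 * M).+2]. *)
pose v i := x 0 i / eta + M%:R.
have hM' : 1 <= M%:R * eta by rewrite /eta -ler_pdivrMr // invf_div mul1r.
have v0 i : 0 <= v i.
  have := coord i; rewrite ler_norml => /andP[xi _].
  rewrite /v -(pmulr_lge0 _ eta0) mulrDl mulfVK ?gt_eqF //; lra.
have v2 i : v i <= (2 * M)%:R.
  have := coord i; rewrite ler_norml => /andP[_ xi].
  rewrite /v natrM -(ler_pM2r eta0) mulrDl mulfVK ?gt_eqF //; lra.
pose b i := Num.truncn (v i).
have bv i : (b i)%:R <= v i by rewrite truncn_le.
have vb i : v i < (b i).+1%:R by exact: truncnS_gt.
have b2 i : (b i <= 2 * M)%N by rewrite -(ler_nat R); exact: le_trans (bv i) (v2 i).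
pose f i := v i - (b i)%:R.
have f01 i : 0 <= f i <= 1.
  have := bv i; have := vb i; rewrite /f -natr1 => ? ?; apply/andP; split; lra.
pose ke (e : {ffun 'I_d.+1 -> bool}) : {ffun 'I_d.+1 -> 'I_(2 * M).+2} :=
  [ffun i => inord (b i + e i)].
have keE e : lattice M eta (ke e) = roundv x eta f e.
  apply/rowP => i; rewrite !mxE ffunE inordK; last first.
    by rewrite ltnS; case: (e i); rewrite ?addn1 ?addn0 ?ltnS //; exact: leqW.
  by rewrite natrD /f /v; field; rewrite gt_eqF.
have near e : near_sphere h (lattice M eta (ke e)).
  apply: (near_sphere_lattice c x1 h0) => i; rewrite keE !mxE addrAC subrr add0r.
  rewrite normrM gtr0_norm // -[leRHS]mulr1 ler_pM2l // ler_norml.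
  have /andP[? ?] := f01 i; by case: (e i); apply/andP; split => /=; lra.
pose G (k : {ffun 'I_d.+1 -> 'I_(2 * M).+2}) := \prod_(z <- s) gain c h J z (lattice M eta k).
have G0 k : 0 <= G k by apply: prodr_ge0 => z _; exact: gain_ge0.
have wG : 1 <= \sum_e roundw f e * G (ke e).
  apply: (@le_trans _ _ (\sum_e roundw f e *
      (1 - \sum_(z <- s) psi (tau c h z (roundv x eta f e))))); last first.
    apply: ler_sum => e _; rewrite ler_wpM2l ?roundw_ge0 //.
    have hexp := expR_ge1Dx (- \sum_(z <- s) psi (tau c h z (roundv x eta f e))).
    apply: le_trans hexp _; rewrite -sumrN expR_sum /G.
    rewrite big_seq [leRHS]big_seq; apply: ler_prod => z zs.
    rewrite expR_ge0 /= -keE; apply: expR_psi_gain => //; exact: s1.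
  under eq_bigr => e _ do rewrite mulrBr mulr1 mulr_sumr.
  rewrite sumrB roundw_sum exchange_big /= lerDl oppr_ge0 big_seq.
  apply: sumr_le0 => z zs.
  by apply: sum_psi_le0 => //; [exact: s1|exact: ltW (sx z zs)].
apply: le_trans wG _.
(* The roundings to one lattice point have total probability at most 1, so each lattice point may be
   counted with weight 1. *)
rewrite (partition_big ke (fun k => near_sphere h (lattice M eta k))) //=.
apply: ler_sum => k _.
apply: (@le_trans _ _ (\sum_(e | ke e == k) roundw f e * G k)).
  by apply: ler_sum => e /eqP ->.
rewrite -mulr_suml -[leRHS]mul1r ler_wpM2r ?G0 //.
rewrite -(roundw_sum f) big_mkcond; apply: ler_sum => e _.
by case: ifP => // _; exact: roundw_ge0.
Qed.

Lemma exists_covering_loglog c : 0 <= c <= 2^-1 -> 0 < capf d c ->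
  exists2 s : seq 'rV[R]_d.+1, covering c s &
    (size s)%:R <= 32 * d.+1%:R * (16 + ln (Num.max 1 (c * Num.sqrt d.+1%:R))) / capf d c + 1.
Proof.
move=> c01 p0; have /andP[c0 c1] := c01.
have [D [DE D1]] : exists D : R, D = d.+1%:R /\ 1 <= D by exists d.+1%:R; rewrite ler1n.
have [q [qE q2 q1]] : exists q : R, [/\ q = Num.sqrt D, q ^+ 2 = D & 1 <= q].
  exists (Num.sqrt D); split => //; first by rewrite sqr_sqrtr //; lra.
  by rewrite -[leLHS]sqrtr1 ler_wsqrtr.
rewrite -DE -qE; set m := Num.max 1 _.
have m1 : 1 <= m by rewrite le_max lexx.
have mq : c * q <= m by rewrite le_max lexx orbT.
have mq0 : 0 < q * m by rewrite mulr_gt0 //; lra.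
(* The factor [q] bounds [h * q], and [m], at least [c * q], bounds [c * h * q ^+ 2], both by
   1/32. *)
pose h := (32 * (q * m))^-1.
have hqm : h * (q * m) = 32^-1 by rewrite /h; field; lra.
have h0 : 0 < h by rewrite invr_gt0; lra.
have h1 : h <= 32^-1 by rewrite -hqm ler_pMr // -[leLHS]mulr1 ler_pM.
have hq : h * q <= 32^-1 by rewrite -hqm mulrA ler_pMr // mulr_gt0 //; lra.
have chD : c * h * d.+1%:R <= 32^-1.
  rewrite -DE -q2 -hqm; have : h * q * (c * q) <= h * q * m.
    by rewrite ler_wpM2l // mulr_ge0 ?(ltW h0) //; lra.
  nra.
have hhD : h ^+ 2 * d.+1%:R <= 1024^-1.
  rewrite -DE -q2 -exprMn (_ : 1024^-1 = 32^-1 ^+ 2); last by field.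
  by apply: lerXn2r; rewrite ?nnegrE ?mulr_ge0 ?(ltW h0) ?invr_ge0 //; lra.
have h01 : 0 < h <= 32^-1 by rewrite h0 h1.
have [J hJ] : exists J, 1 + 3 / h <= J%:R.
  by exists (Num.truncn (1 + 3 / h)).+1; exact: ltW (truncnS_gt _).
have [M hM] : exists M, 56 / h <= M%:R.
  by exists (Num.truncn (56 / h)).+1; exact: ltW (truncnS_gt _).
pose K := {ffun 'I_d.+1 -> 'I_(2 * M).+2}.
pose Y := [seq k <- index_enum K | near_sphere h (lattice M (h / 56) k)].
have nearY : {in Y, forall k, near_sphere h (lattice M (h / 56) k)}.
  by move=> k; rewrite mem_filter => /andP[].
pose L := 16 + ln m.
(* Points near the sphere have norm at most 5/4, so [lattice_count] applies; there
   [4 / rho = 7168 * m <= expR 13 * m]. *)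
have sY : (size Y)%:R <= expR (D * L).
  have [rho [rhoE rho0 rho1]] : exists rho : R, [/\ rho = h / 56 * q, 0 < rho & rho <= 1].
    exists (h / 56 * q); split => //; first by rewrite mulr_gt0 ?divr_gt0 //; lra.
    by rewrite mulrAC; lra.
  have rho2 : rho ^+ 2 = (h / 56) ^+ 2 * d.+1%:R by rewrite rhoE exprMn q2 DE.
  have rho01 : 0 < rho <= 1 by rewrite rho0 rho1.
  have hc := lattice_count (2 * M).+2 M rho01 rho2.
  have -> : (size Y)%:R = \sum_(k : K | near_sphere h (lattice M (h / 56) k)) 1 :> R.
    by rewrite -sum1_size natr_sum big_filter.
  apply: (@le_trans _ _ ((expR 3 * (4 / rho)) ^+ d.+1)).
    apply: le_trans hc; rewrite big_mkcond [leRHS]big_mkcond.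
    apply: ler_sum => k _; case: ifP => [kn|_]; last by case: ifP.
    have [r34 r54 _] := near_sphere_bounds h0 hhD kn.
    by rewrite -sqr_enorm ifT //; nra.
  rewrite DE expRM_natl; apply: lerXn2r; rewrite ?nnegrE ?expR_ge0 //.
    by rewrite mulr_ge0 ?expR_ge0 // divr_ge0 // ltW.
  have -> : expR L = expR 3 * (expR 13%:R * m).
    rewrite -[m in RHS]lnK ?posrE; last by lra.
    by rewrite -!expRD; congr expR; rewrite /L; lra.
  have -> : 4 / rho = 7168 * m by rewrite rhoE /h; field; lra.
  rewrite ler_wpM2l ?expR_ge0 // ler_wpM2r //; first by lra.
  by apply: le_trans (expR_nat_ge R 13); rewrite -natrX ler_nat.
have p1 := capf_le1 d c.
set p := capf d c in p0 p1 *.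
have th0 : 0 <= 1 - p / 32 by lra.
(* Enough choices to bring the sum of gains, initially at most [expR (D * L)], strictly below 1,
   against [uncovered_gain]. *)
have [N [NE1 NE2]] : exists N : nat, 32 * D * L / p < N%:R /\ N%:R <= 32 * D * L / p + 1.
  exists (Num.truncn (32 * D * L / p)).+1; split; first exact: truncnS_gt.
  rewrite -natr1 lerD2r truncn_le // divr_ge0 ?(ltW p0) //.
  rewrite mulr_ge0 ?addr_ge0 ?ln_ge0 //; lra.
have [s [sN s1 hs]] := @greedy R d _ Y (fun z k => gain c h J z (lattice M (h / 56) k)) _ N
  (fun z k => gain_ge0 c h J z _) th0 (gain_average J c01 h01 chD hhD nearY).
exists s; last by rewrite sN.
split => // x x1; apply: contrapT => nx.
have sx : {in s, forall z, dotmul z x < c}.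
  by move=> z zs; rewrite ltNge; apply/negP => cz; apply: nx; exists z.
have := uncovered_gain c01 h01 chD hhD hJ hM s1 x1 sx.
rewrite -big_filter -/Y => /le_trans /(_ hs); apply/negP; rewrite -ltNge.
apply: (@le_lt_trans _ _ (expR (- (p / 32)) ^+ N * expR (D * L))).
  apply: ler_pM => //; first exact: exprn_ge0.
  by apply: lerXn2r; rewrite ?nnegrE ?expR_ge0 //; have := expR_ge1Dx (- (p / 32)).
rewrite -expRM_natl -expRD -[ltRHS]expR0 ltr_expR.
move: NE1; rewrite ltr_pdivrMr //; lra.
Qed.

End large_caps.

(** * Choice of the cap *)

Section bounds.
Context (R : realType) (d : nat).

Lemma capf_le_expR (c : R) : 0 <= c -> c ^+ 2 <= 2^-1 ->
  capf d c <= expR (- (c ^+ 2 * d.+1%:R / 2)).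
Proof.
move=> c0 c2; apply: le_trans (capf_le_sqrt d c0 c2) _.
have h : Num.sqrt (1 - c ^+ 2) <= expR (- (c ^+ 2 / 2)).
  rewrite -(ler_pXn2r (ltn0Sn 1)) ?nnegrE ?sqrtr_ge0 ?expR_ge0 //.
  rewrite sqr_sqrtr; last by lra.
  rewrite -expRM_natl (_ : 2%:R * - (c ^+ 2 / 2) = - c ^+ 2); last by field.
  exact: expR_ge1Dx.
apply: (@le_trans _ _ (expR (- (c ^+ 2 / 2)) ^+ d.+1)).
  by apply: lerXn2r; rewrite ?nnegrE ?sqrtr_ge0 ?expR_ge0.
rewrite -expRM_natl (_ : _ * - (c ^+ 2 / 2) = - (c ^+ 2 * d.+1%:R / 2)) //.
by field.
Qed.

(** Keeps [ln (ln m)] away from 0, so that it can absorb additive constants. *)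
Lemma lnln_bounds (m : R) : 4 <= m -> 1 <= ln m /\ 5^-1 <= ln (ln m).
Proof.
move=> m4; have h : expR (5 / 4) <= m.
  apply: le_trans m4.
  have -> : 5 / 4 = 10%:R * 8^-1 :> R by field.
  rewrite expRM_natl.
  apply: (@le_trans _ _ ((8 / 7) ^+ 10)); last by rewrite !exprS expr0; lra.
  have h8 : expR (8^-1 : R) <= 8 / 7.
    have -> : 8 / 7 = (1 - 8^-1)^-1 :> R by field.
    by apply: expR_le_inv; lra.
  by apply: lerXn2r => //; rewrite nnegrE ?expR_ge0 //; lra.
have m0 : 0 < m by lra.
have lm : 5 / 4 <= ln m by rewrite -ler_expR lnK ?posrE.
split; first lra.
rewrite -ler_expR lnK ?posrE; last by lra.
apply: le_trans lm; have -> : 5 / 4 = (1 - 5^-1)^-1 :> R by field.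
by apply: expR_le_inv; lra.
Qed.

Lemma ln_le_of_expR_ge (p m a : R) : 0 < p -> 0 < m -> 1 <= p * m ->
  p <= expR (- a) -> a <= ln m.
Proof.
move=> p0 m0 pm pa; rewrite -ler_expR lnK ?posrE //.
have h : p * expR a <= 1.
  by rewrite -(expRxMexpNx_1 a) mulrC ler_wpM2l ?expR_ge0.
have := expR_gt0 a; nra.
Qed.

(** As [m] is at least the inverse of the measure, [capf_le_expR] gives [c * sqrt D <= 2 * ln m] if
    [c <= 1/2], and [D <= 8 * ln m] otherwise. Either way the logarithm in the covering bound is at
    most a constant plus [ln (ln m)]. *)
Lemma exists_small_covering (c m : R) : 0 <= c < 1 -> 0 < capf d c -> 4 <= m ->
  1 <= capf d c * m ->
  exists2 s : seq 'rV[R]_d.+1, covering c s &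
    (size s)%:R <= 30 * 100 * d.+1%:R * ln (ln m) / capf d c + 1.
Proof.
move=> /andP[c0 c1] p0 m4 pm; have [e1 L5] := lnln_bounds m4.
have m0 : 0 < m by lra.
set L := ln (ln m) in L5 *;
have D1 : 1 <= d.+1%:R :> R by rewrite ler1n.
have [ch|ch] := leP c 2^-1.
  have c01 : 0 <= c <= 2^-1 by rewrite c0 ch.
  have [s cs ss] := exists_covering_loglog c01 p0.
  exists s => //; apply: le_trans ss _; rewrite lerD2r ler_pM2r ?invr_gt0 //.
  have cD : c ^+ 2 * d.+1%:R / 2 <= ln m.
    by apply: ln_le_of_expR_ge p0 m0 pm (capf_le_expR c0 _); nra.
  have hm : Num.max 1 (c * Num.sqrt d.+1%:R) <= 2 * ln m.
    rewrite ge_max; apply/andP; split; first by lra.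
    rewrite -(ler_pXn2r (ltn0Sn 1)) ?nnegrE ?mulr_ge0 ?sqrtr_ge0 //; last by lra.
    rewrite exprMn sqr_sqrtr //; nra.
  have hl : ln (Num.max 1 (c * Num.sqrt d.+1%:R)) <= 1 + L.
    have M1 : 0 < Num.max 1 (c * Num.sqrt d.+1%:R) by rewrite lt_max ltr01.
    rewrite -ler_expR lnK ?posrE // expRD lnK ?posrE; last by lra.
    apply: le_trans hm _; rewrite ler_wpM2r ?expR1_ge2 //; lra.
  nra.
have c01 : 0 <= c < 1 by rewrite c0 c1.
have [s cs ss] := exists_covering_log c01 p0.
exists s => //; apply: le_trans ss _; rewrite lerD2r ler_pM2r ?invr_gt0 //.
have De : d.+1%:R / 8 <= ln m.
  apply: ln_le_of_expR_ge p0 m0 pm _.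
  apply: le_trans (capf_antitone d (ltW ch)) _.
  have h2 : (2^-1 : R) ^+ 2 <= 2^-1 by lra.
  apply: le_trans (capf_le_expR _ h2) _; first by lra.
  by rewrite ler_expR; lra.
have hl : ln (8 * d.+1%:R) <= 6 + L.
  rewrite -ler_expR lnK ?posrE; last by lra.
  rewrite expRD lnK ?posrE; last by lra.
  apply: (@le_trans _ _ (2 ^+ 6 * ln m)); first by rewrite !exprS expr0; lra.
  by rewrite ler_wpM2r ?(expR_nat_ge R 6) //; lra.
nra.
Qed.

End bounds.

(** * The dispersion bound, from a covering by at most n caps *)

Local Open Scope ring_scope.

Theorem theorem1p7 (R : realType) :
  exists C : R, 1 < C /\
    forall d n : nat, (2 <= d)%N -> (2 * d <= n)%N ->
      (n%:R%:E * disp R n d <= (C * d%:R * ln (ln (2 * n%:R / d%:R)))%:E)%E.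
Proof.
have [C2 C2E] : exists C2 : R, C2 = 100 * 100 by eexists.
have C21 : 9 <= C2 by lra.
(* [C2] leaves room for [D + 1] in place of [D], for the loss of 1 in [N - 1] and for the halving of
   [p0]. *)
have size_bound (p0 D L N : R) : 2 <= D -> 5^-1 <= L -> 0 < p0 <= 2^-1 ->
    p0 * N = C2 * (D * L) -> 30 * 100 * (D + 1) * L <= (N - 1) * (p0 / 2).
  move=> D2 L5 /andP[p00 p02] p0N.
  have DL : 2 / 5 <= D * L by nra.
  have L0 : 0 <= L * (D - 2) by rewrite mulr_ge0 //; lra.
  rewrite C2E in p0N; lra.
clear C2E.
exists (2 * C2); split; first by lra.
move=> d n d2 dn.
have d0 : 2 <= d%:R :> R by rewrite ler_nat.
have dn0 : 0 < d%:R :> R by lra.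
have n2 : 2 * d%:R <= n%:R :> R by rewrite -natrM ler_nat.
have nn0 : 0 < n%:R :> R by lra.
have n0 : (0 < n)%N by rewrite -(ltr0n R).
have [m mE] : exists m : R, m = 2 * n%:R / d%:R by eexists.
have m4 : 4 <= m by rewrite mE ler_pdivlMr //; lra.
rewrite -mE; have [_ L5] := lnln_bounds m4.
have [L LE] : exists L, L = ln (ln m) by eexists.
rewrite -LE in L5 *.
have dL : 0 < d%:R * L by rewrite mulr_gt0 //; lra.
have C20 : 0 < C2 by lra.
(* The measure aimed at: a covering by at most [n] caps of measure below [p0] gives the bound. *)
have [p0 p0E] : exists p0, p0 = C2 * (d%:R * L) / n%:R by eexists.
have p0n : p0 * n%:R = C2 * (d%:R * L) by rewrite p0E mulfVK // gt_eqF.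
have p00 : 0 < p0 by rewrite p0E divr_gt0 // mulr_gt0.
(* If [p0 > 1/2], the trivial bound 1 on the dispersion suffices, thanks to the factor 2 in
   [2 * C2]. *)
have [p02|p02] := leP p0 2^-1; last first.
  apply: (@le_trans _ _ (n%:R%:E * 1)%E).
    by rewrite lee_wpmul2l ?lee_fin ?disp_le1.
  rewrite mule1 lee_fin -!mulrA -p0n mulrCA mulrA mulrC.
  by rewrite -[leLHS]mulr1 ler_pM2l //; lra.
have d_gt0 : (0 < d)%N by rewrite (leq_trans _ d2).
have p012 : 0 < p0 <= 2^-1 by rewrite p00 p02.
have [c [c01 pc cp]] := cap_choice d_gt0 p012.
have ph0 : 0 < p0 / 2 by rewrite divr_gt0.
have cf0 : 0 < capf d c by exact: lt_le_trans pc.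
have pm : 1 <= capf d c * m.
  apply: (@le_trans _ _ (p0 / 2 * m)); last by rewrite ler_pM2r //; lra.
  have -> : p0 / 2 * m = C2 * L.
    by rewrite p0E mE; field; rewrite (gt_eqF nn0) (gt_eqF dn0).
  by apply: (@le_trans _ _ (9 * 5^-1)); [lra|apply: ler_pM].
have [s cs ss] := exists_small_covering c01 cf0 m4 pm.
have sn : (size s <= n)%N.
  rewrite -(ler_nat R); apply: le_trans ss _; rewrite -lerBrDr ler_pdivrMr //.
  apply: (@le_trans _ _ ((n%:R - 1) * (p0 / 2))); last by rewrite ler_wpM2l //; lra.
  by rewrite -LE -(natr1 d); exact: size_bound.
apply: (@le_trans _ _ (n%:R%:E * (capf d c)%:E)%E).
  by rewrite lee_wpmul2l ?lee_fin // (disp_le_capf sn cs.1 cs.2).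
rewrite -EFinM lee_fin; apply: (@le_trans _ _ (n%:R * p0)).
  by rewrite ler_wpM2l // ltW.
by rewrite mulrC p0n -!mulrA ler_peMl ?ler1n // mulr_ge0 ?(ltW C20) ?(ltW dL).
Qed.
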